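(* Assume that there are constants $A,B,\ell>0$ and a function $h$ such that $\mathcal{K}(r)=A+Br^{\ell}+h(r)$ and $\lim_{r\to 0}\frac{|h(r)|+r|h'(r)|}{r^{\ell}}=0$. Let $\ell_p^*=\frac{n-p}{p-1}$. For $\mathcal{R}>0$ consider the problem $$\Delta_p u(x)+\mathcal{K}(|x|)\,u(x)|u(x)|^{q-2}=0,\quad u(x)>0 \text{ for } |x|<\mathcal{R},\quad u(x)=0 \text{ for } |x|=\mathcal{R}.\qquad (P_{\mathcal{R}})$$ (i) If $\ell<\ell_p^*$, then $(P_{\mathcal{R}})$ admits a radial solution for every $\mathcal{R}>0$. (ii) If $\ell\ge \ell_p^*$, then there exists $\mathcal{R}_0>0$ such that $(P_{\mathcal{R}})$ does not admit any radial solution when $\mathcal{R}<\mathcal{R}_0$.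
   Context: Standing assumptions: $n$ is a positive integer (the space dimension, $x\in\mathbb{R}^n$), $p$ is real with $1<p<n$ and $\frac{2n}{n+2}\le p\le 2$, $q=\frac{np}{n-p}$, and $\mathcal{K}:[0,+\infty)\to(0,+\infty)$ is $C^1$. $\Delta_p u=\operatorname{div}(\nabla u|\nabla u|^{p-2})$. Radial solutions $u=u(r)$, $r=|x|$, solve $(r^{n-1}u'|u'|^{p-2})'+r^{n-1}\mathcal{K}(r)u|u|^{q-2}=0$. For each $d>0$ there is a unique (regular) solution $u(r;d)$ of this ODE with $\lim_{r\to0}u(r;d)=d$; it satisfies $u'(0;d)=0$. A radial solution of $(P_{\mathcal{R}})$ is a regular solution $u(\cdot;d)$, $d>0$, with $u(r;d)>0$ for $0\le r<\mathcal{R}$ and $u(\mathcal{R};d)=0$. *)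

(* Defs.v *)
(* Stdlib reals with Coquelicot. *)
From Stdlib Require Import Reals.
From Coquelicot Require Import Coquelicot.

Open Scope R_scope.

(* [x ^ a] for [0 <= x] and [a > 0]: unlike [Rpower], which has
   [Rpower 0 a = 1], this gives [0 ^ a = 0]. *)
Definition rpow (x a : R) : R :=
  if Rlt_dec 0 x then Rpower x a else 0.

(* [s |s|^(m-2)], with the usual value [0] at [s = 0] even when [m < 2]:
   the factor [s] kills the junk value [Rpower 0 _ = 1]. *)
Definition signed_pow (m s : R) : R := s * Rpower (Rabs s) (m - 2).

Definition critical_exponent (n : nat) (p : R) : R := INR n * p / (INR n - p).

Definition ell_star (n : nat) (p : R) : R := (INR n - p) / (p - 1).

(* [f] is C^1 on the closed half-line [0, +oo): at [0] the derivative and its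
   continuity are one-sided. Values of [f] on negative reals are irrelevant. *)
Definition C1_halfline (f : R -> R) : Prop :=
  exists f' : R -> R,
    forall r : R, 0 <= r ->
      filterlim (fun s => (f s - f r) / (s - r))
                (within (fun s => 0 <= s /\ s <> r) (locally r))
                (locally (f' r)) /\
      filterlim f' (within (fun s => 0 <= s) (locally r)) (locally (f' r)).

(* The equation (r^(n-1) u' |u'|^(p-2))' + r^(n-1) K(r) u |u|^(q-2) = 0 at [r],
   in the classical sense; the two [ex_derive] make the total [Derive]
   meaningful ([u] is required to be differentiable only at [r], but the
   equation is always imposed on an open interval). *)
Definition radial_ode (n : nat) (p : R) (K u : R -> R) (r : R) : Prop :=
  let flux := fun s => s ^ (n - 1) * signed_pow p (Derive u s) in
  ex_derive u r /\ ex_derive flux r /\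
  Derive flux r
    + r ^ (n - 1) * K r * signed_pow (critical_exponent n p) (u r) = 0.

(* [u] restricted to [0, T) is the regular solution u(.;d), which is
   characterised by its limit [d] at the origin; u'(0;d) = 0 is then a
   consequence (as p < n) and is not imposed. *)
Definition regular_solution
    (n : nat) (p : R) (K : R -> R) (d T : R) (u : R -> R) : Prop :=
  u 0 = d /\
  filterlim u (at_right 0) (locally d) /\
  forall r : R, 0 < r < T -> radial_ode n p K u r.

(* Only [T > Rad] is asked of the interval of existence [0, T), so that the
   equation also holds at [r = Rad]. *)
Definition radial_solution
    (n : nat) (p : R) (K : R -> R) (Rad : R) (u : R -> R) : Prop :=
  exists d T : R,
    0 < d /\ Rad < T /\ regular_solution n p K d T u /\
    (forall r : R, 0 <= r < Rad -> 0 < u r) /\ u Rad = 0.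

(* Main.v *)
(** In terms of the flux w = r^(n-1) |u'|^(p-1) the equation becomes the system
    u' = - w^(1/(p-1)) r^(-ell-1),  w' = r^(n-1) K u^(q-1),  with ell = (n-p)/(p-1),
    and the Pohozaev functional
      P = (p-1)/p w^(p/(p-1)) r^(-ell) - (n/q) w u + (1/q) K r^n u^q
    satisfies P(0+) = 0 and P' = (1/q) K' r^n u^q.

    If u vanishes at R, then u <= W^(1/(p-1)) r^(-ell) / ell on (0, R), where
    W = w(R). For l >= ell and K' <= C r^(l-1) this bounds P' by a constant times
    R^(l-ell) W^(1/(p-1)) w', so that P(R) <= C' R^(l-ell) W^(p/(p-1)). Since
    P(R) = (p-1)/p W^(p/(p-1)) R^(-ell), the radius R cannot be small.

    Let now l < ell and suppose that u(.;d) is positive on a fixed interval (0, rho)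
    on which K' >= c r^(l-1). Then P >= 0, which makes w r^(-n) u^(-n(p-1)/(n-p))
    nondecreasing; integrating, u(rho/2) = O(d^(-1/(p-1))), and the monotonicity
    of w gives P(rho/2) = O(d^(-p/(p-1))). On the other hand u >= d/2 for
    r <= eps d^(-p/(n-p)), whence P(rho/2) >= c' d^(-pl/(n-p)), which is larger for
    large d. So u(.;d) vanishes before any given radius when d is large, whereas it
    stays positive there when d is small because q > p. The bounds on p make the
    system locally Lipschitz, so solutions depend continuously on d, and a
    parameter at which positivity on the ball is lost gives the solution. *)

Require Import Defs.
From Stdlib Require Import Reals Lra Lia Psatz Classical.
From Coquelicot Require Import Coquelicot.

Open Scope R_scope.

(** * Powers and monotonicity *)

(** No information on [u'] or on the flux at the origin is given, only [u -> d]. Positivity and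
    smallness of the flux near [0] are therefore derived from the fact that otherwise [u] would
    behave like a multiple of [r^(-ell)], and comparisons starting at [0] use a lower bound
    [- C r^a] in place of an initial value. In the existence part, continuity of the first zero of
    [u(.;d)] in [d] is never studied. The supremum of the parameters up to which [u(.;d)] stays
    positive on the closed ball gives a nonnegative solution with a zero, and strict decrease forces
    this zero to lie on the boundary. The level [M] at which the nonlinearity is truncated is also
    the large parameter at which positivity is known to fail: a nonnegative solution with [d <= M]
    takes values in [[0, M]] and never meets the truncation. *)

Lemma Rpower_gt_0 (x a : R) : 0 < Rpower x a.
Proof. apply exp_pos. Qed.

Lemma Rpower_1_l (a : R) : Rpower 1 a = 1.
Proof. unfold Rpower; rewrite ln_1, Rmult_0_r; apply exp_0. Qed.

Lemma Rpower_le_neg (a x y : R) : a <= 0 -> 0 < x <= y -> Rpower y a <= Rpower x a.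
Proof.
intros Ha [Hx Hxy].
rewrite <- (Ropp_involutive a), 2!(Rpower_Ropp _ (- a)).
apply Rinv_le_contravar; [apply Rpower_gt_0 | apply Rle_Rpower_l; lra].
Qed.

Ltac pos :=
  repeat first
    [ assumption | apply Rpower_gt_0 | apply Rmult_lt_0_compat
    | apply Rdiv_lt_0_compat | apply Rinv_0_lt_compat | lra ].

Ltac rpower_eq :=
  apply ln_inv; [pos | pos |];
  unfold Rdiv; repeat first [rewrite ln_mult by pos | rewrite ln_Rinv by pos | rewrite ln_Rpower];
  field; repeat split; try lra.

Lemma is_derive_Rpower_comp (g : R -> R) (a x dg : R) :
  0 < g x -> is_derive g x dg ->
  is_derive (fun s => Rpower (g s) a) x (a * Rpower (g x) (a - 1) * dg).
Proof.
intros Hg Hd.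
replace (a * Rpower (g x) (a - 1) * dg)
  with (scal dg (a * Rpower (g x) (a - 1))) by (unfold scal; simpl; unfold mult; simpl; ring).
apply (is_derive_comp (fun y => Rpower y a) g x); [|exact Hd].
apply is_derive_Reals; apply derivable_pt_lim_power; exact Hg.
Qed.

Lemma is_derive_Rpower (a x : R) :
  0 < x -> is_derive (fun s => Rpower s a) x (a * Rpower x (a - 1)).
Proof. intros Hx; apply is_derive_Reals, derivable_pt_lim_power, Hx. Qed.

Lemma le_of_derive_ge_0 (f df : R -> R) (a b : R) :
  a <= b ->
  (forall x, a < x < b -> is_derive f x (df x)) ->
  (forall x, a <= x <= b -> continuous f x) ->
  (forall x, a < x < b -> 0 <= df x) ->
  f a <= f b.
Proof.
intros Hab Hd Hc Hp.
(* [MVT_gen] may return an endpoint, where the sign of [df] is unknown; there the derivative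
   function is given a value of the required sign. *)
destruct (MVT_gen f a b
  (fun x => if Rlt_dec a x then if Rlt_dec x b then df x else 0 else 0))
  as [c [_ Hfc]]; rewrite ?Rmin_left, ?Rmax_right by lra.
- intros x Hx; destruct (Rlt_dec a x); [|lra].
  destruct (Rlt_dec x b); [apply Hd|]; lra.
- intros x Hx; apply continuity_pt_filterlim, Hc; exact Hx.
- cut (0 <= f b - f a); [lra | rewrite Hfc].
  apply Rmult_le_pos; [|lra].
  destruct (Rlt_dec a c); [|lra].
  destruct (Rlt_dec c b); [apply Hp|]; lra.
Qed.

Lemma lt_of_derive_gt_0 (f df : R -> R) (a b : R) :
  a < b ->
  (forall x, a < x < b -> is_derive f x (df x)) ->
  (forall x, a <= x <= b -> continuous f x) ->
  (forall x, a < x < b -> 0 < df x) ->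
  f a < f b.
Proof.
intros Hab Hd Hc Hp.
destruct (MVT_gen f a b
  (fun x => if Rlt_dec a x then if Rlt_dec x b then df x else 1 else 1))
  as [c [_ Hfc]]; rewrite ?Rmin_left, ?Rmax_right by lra.
- intros x Hx; destruct (Rlt_dec a x); [|lra].
  destruct (Rlt_dec x b); [apply Hd|]; lra.
- intros x Hx; apply continuity_pt_filterlim, Hc; exact Hx.
- cut (0 < f b - f a); [lra | rewrite Hfc].
  apply Rmult_lt_0_compat; [|lra].
  destruct (Rlt_dec a c); [|lra].
  destruct (Rlt_dec c b); [apply Hp|]; lra.
Qed.

Lemma is_derive_continuous (f : R -> R) (x l : R) : is_derive f x l -> continuous f x.
Proof.
intros H; apply (ex_derive_continuous (K := R_AbsRing) (V := R_NormedModule)).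
exists l; exact H.
Qed.

Lemma is_derive_Rplus (f g : R -> R) (x a b : R) :
  is_derive f x a -> is_derive g x b -> is_derive (fun t => f t + g t) x (a + b).
Proof. exact (is_derive_plus f g x a b). Qed.

Lemma is_derive_Rminus (f g : R -> R) (x a b : R) :
  is_derive f x a -> is_derive g x b -> is_derive (fun t => f t - g t) x (a - b).
Proof. exact (is_derive_minus f g x a b). Qed.

Lemma is_derive_Ropp (f : R -> R) (x a : R) :
  is_derive f x a -> is_derive (fun t => - f t) x (- a).
Proof. exact (is_derive_opp f x a). Qed.

Lemma is_derive_Rscal (f : R -> R) (k x a : R) :
  is_derive f x a -> is_derive (fun t => k * f t) x (k * a).
Proof. exact (is_derive_scal f x k a). Qed.

Lemma is_derive_Rmult (f g : R -> R) (x a b : R) :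
  is_derive f x a -> is_derive g x b ->
  is_derive (fun t => f t * g t) x (a * g x + f x * b).
Proof. intros Hf Hg; apply (is_derive_mult f g x a b Hf Hg Rmult_comm). Qed.

Lemma le_of_derive_ge_0_open (f df : R -> R) (a b x y : R) :
  (forall s, a < s < b -> is_derive f s (df s)) ->
  (forall s, a < s < b -> 0 <= df s) ->
  a < x -> x <= y -> y < b -> f x <= f y.
Proof.
intros Hd Hp Hx Hxy Hy; apply (le_of_derive_ge_0 f df); try lra.
- intros s Hs; apply Hd; lra.
- intros s Hs; apply (is_derive_continuous f s (df s)), Hd; lra.
- intros s Hs; apply Hp; lra.
Qed.

Lemma lt_of_derive_gt_0_open (f df : R -> R) (a b x y : R) :
  (forall s, a < s < b -> is_derive f s (df s)) ->
  (forall s, a < s < b -> 0 < df s) ->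
  a < x -> x < y -> y < b -> f x < f y.
Proof.
intros Hd Hp Hx Hxy Hy; apply (lt_of_derive_gt_0 f df); try lra.
- intros s Hs; apply Hd; lra.
- intros s Hs; apply (is_derive_continuous f s (df s)), Hd; lra.
- intros s Hs; apply Hp; lra.
Qed.

Lemma Rpower_small (a C eps : R) :
  0 < a -> 0 < eps -> exists delta, 0 < delta /\
    forall s, 0 < s <= delta -> C * Rpower s a <= eps.
Proof.
intros Ha He.
(* [C] may be zero or negative; [D] is a positive majorant. *)
set (D := Rmax C 1).
assert (HD : 1 <= D) by apply Rmax_r.
assert (HC : C <= D) by apply Rmax_l.
exists (Rpower (eps / D) (/ a)); split; [apply Rpower_gt_0|].
intros s [Hs Hsd].
assert (Hq : 0 < eps / D) by (apply Rdiv_lt_0_compat; lra).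
assert (H : Rpower s a <= eps / D).
{ apply Rle_trans with (Rpower (Rpower (eps / D) (/ a)) a).
  - apply Rle_Rpower_l; lra.
  - rewrite Rpower_mult, Rinv_l, Rpower_1 by lra; lra. }
apply Rle_trans with (D * Rpower s a).
- apply Rmult_le_compat_r; [left; apply Rpower_gt_0 | exact HC].
- apply Rle_trans with (D * (eps / D)); [apply Rmult_le_compat_l; lra|].
  right; field; lra.
Qed.

(** Comparison from the origin without a value or a limit there: if [f r < 0], monotonicity keeps
    [f] below [f r] on [(0, r)], against the lower bound, which tends to [0]. *)
Lemma ge_0_of_derive_ge_0 (f df : R -> R) (C a R0 r : R) :
  0 < a ->
  (forall s, 0 < s < R0 -> is_derive f s (df s)) ->
  (forall s, 0 < s < R0 -> 0 <= df s) ->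
  (forall s, 0 < s < R0 -> - (C * Rpower s a) <= f s) ->
  0 < r < R0 -> 0 <= f r.
Proof.
intros Ha Hd Hp Hb Hr.
apply Rnot_lt_le; intros Hneg.
destruct (Rpower_small a C (- f r / 2)) as [delta [Hdelta Hs]]; [lra | lra |].
set (s := Rmin delta r).
assert (H1 : s <= delta) by apply Rmin_l.
assert (H2 : s <= r) by apply Rmin_r.
assert (H3 : 0 < s) by (apply Rmin_glb_lt; lra).
assert (H4 : f s <= f r) by (apply (le_of_derive_ge_0_open f df 0 R0); auto; lra).
specialize (Hb s ltac:(lra)); specialize (Hs s ltac:(lra)); lra.
Qed.

(** * Positive solutions near the origin *)

Lemma signed_pow_pos (m s : R) : 0 < s -> signed_pow m s = Rpower s (m - 1).
Proof.
intros Hs; unfold signed_pow; rewrite Rabs_pos_eq by lra.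
rpower_eq.
Qed.

Lemma signed_pow_opp (m s : R) : signed_pow m (- s) = - signed_pow m s.
Proof. unfold signed_pow; rewrite Rabs_Ropp; ring. Qed.

Lemma signed_pow_0 (m : R) : signed_pow m 0 = 0.
Proof. unfold signed_pow; ring. Qed.

(** [signed_pow m] has exponent [m - 1], and conjugate exponents satisfy
    [(p - 1) (p/(p-1) - 1) = 1]. This inverts the flux. *)
Lemma signed_pow_conj (p s : R) :
  1 < p -> signed_pow (p / (p - 1)) (signed_pow p s) = s.
Proof.
intros Hp.
assert (Hpos : forall t, 0 < t -> signed_pow (p / (p - 1)) (signed_pow p t) = t).
{ intros t Ht; rewrite (signed_pow_pos p t Ht).
  rewrite signed_pow_pos by apply Rpower_gt_0; rpower_eq. }
destruct (Rtotal_order s 0) as [Hs | [Hs | Hs]]; [| subst; now rewrite 2!signed_pow_0 | auto].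
rewrite <- (Ropp_involutive s) at 1; rewrite 2!signed_pow_opp, Hpos; lra.
Qed.

Lemma signed_pow_conj' (p s : R) :
  1 < p -> signed_pow p (signed_pow (p / (p - 1)) s) = s.
Proof.
intros Hp.
assert (Hpos : forall t, 0 < t -> signed_pow p (signed_pow (p / (p - 1)) t) = t).
{ intros t Ht; rewrite (signed_pow_pos (p / (p - 1)) t Ht).
  rewrite signed_pow_pos by apply Rpower_gt_0; rpower_eq. }
destruct (Rtotal_order s 0) as [Hs | [Hs | Hs]]; [| subst; now rewrite 2!signed_pow_0 | auto].
rewrite <- (Ropp_involutive s) at 1; rewrite 2!signed_pow_opp, Hpos; lra.
Qed.

Lemma at_right_0_elim (P : R -> Prop) :
  at_right 0 P -> exists delta, 0 < delta /\ forall s, 0 < s < delta -> P s.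
Proof.
intros [delta H]; exists delta; split; [apply cond_pos|].
intros s Hs; apply H; [|lra].
unfold ball; simpl; unfold AbsRing_ball, abs, minus, plus, opp; simpl.
rewrite Rabs_pos_eq; lra.
Qed.

Lemma filterlim_at_right_0_elim (f : R -> R) (y : R) :
  filterlim f (at_right 0) (locally y) ->
  forall eps, 0 < eps -> exists delta, 0 < delta /\
    forall s, 0 < s < delta -> Rabs (f s - y) < eps.
Proof.
intros H eps He.
apply at_right_0_elim.
apply (H (fun z => Rabs (z - y) < eps)).
exists (mkposreal eps He); intros z Hz; exact Hz.
Qed.

(* [crit (INR n)] and [ell (INR n)] are convertible to [critical_exponent n] and
   [ell_star n]; the estimates on positive solutions hold in any real dimension. *)
Definition crit (N p : R) : R := N * p / (N - p).
Definition ell (N p : R) : R := (N - p) / (p - 1).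

(** A positive solution of the first-order system. The behaviour of [w] at the origin is not
    recorded: it is recovered from [profile_lim]. *)
Record profile (N p : R) (K u w : R -> R) (d R0 : R) : Prop := {
  profile_u_gt_0 : forall r, 0 < r < R0 -> 0 < u r;
  profile_w_gt_0 : forall r, 0 < r < R0 -> 0 < w r;
  profile_du : forall r, 0 < r < R0 ->
    is_derive u r (- (Rpower (w r) (1 / (p - 1)) * Rpower r (- ell N p - 1)));
  profile_dw : forall r, 0 < r < R0 ->
    is_derive w r (Rpower r (N - 1) * K r * Rpower (u r) (crit N p - 1));
  profile_lim : forall eps, 0 < eps -> exists delta, 0 < delta /\
    forall s, 0 < s < delta -> Rabs (u s - d) < eps;
  profile_u_le : forall r, 0 < r < R0 -> u r <= d }.

Lemma crit_gt (N p : R) : 1 < p < N -> p < crit N p.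
Proof.
intros Hp; unfold crit; apply Rmult_lt_reg_r with (N - p); [lra|].
unfold Rdiv; rewrite Rmult_assoc, Rinv_l by lra; nra.
Qed.

Lemma ell_gt_0 (N p : R) : 1 < p < N -> 0 < ell N p.
Proof. intros Hp; apply Rdiv_lt_0_compat; lra. Qed.

(** The exponents agree because [(N - 1)/(p - 1) = ell + 1]. *)
Lemma flux_power (N p w r : R) : 1 < p < N -> 0 < w -> 0 < r ->
  signed_pow (p / (p - 1)) (w / Rpower r (N - 1)) =
  Rpower w (1 / (p - 1)) * Rpower r (- ell N p - 1).
Proof.
intros Hp Hw Hr; rewrite signed_pow_pos by pos.
unfold ell; rpower_eq.
Qed.

Lemma Rpower_neg_unbounded (a k C r1 : R) :
  0 < a -> 0 < k -> 0 < r1 -> exists r, 0 < r < r1 /\ C < k * Rpower r (- a).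
Proof.
intros Ha Hk Hr1.
set (D := Rmax C 1).
assert (HD : 1 <= D) by apply Rmax_r.
assert (HC : C <= D) by apply Rmax_l.
destruct (Rpower_small a 1 (k / (2 * D)) Ha) as [delta [Hdelta H]]; [pos|].
set (r := Rmin delta (r1 / 2)).
assert (H1 : r <= delta) by apply Rmin_l.
assert (H2 : r <= r1 / 2) by apply Rmin_r.
assert (H3 : 0 < r) by (apply Rmin_glb_lt; lra).
exists r; split; [lra|].
specialize (H r ltac:(lra)); rewrite Rmult_1_l in H.
rewrite Rpower_Ropp.
assert (Hp := Rpower_gt_0 r a).
apply Rmult_lt_reg_r with (Rpower r a); [exact Hp|].
rewrite Rmult_assoc, Rinv_l, Rmult_1_r by lra.
apply Rle_lt_trans with (D * Rpower r a); [apply Rmult_le_compat_r; lra|].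
apply Rle_lt_trans with (D * (k / (2 * D))); [apply Rmult_le_compat_l; lra|].
replace (D * (k / (2 * D))) with (k / 2) by (field; lra); lra.
Qed.

(* If the flux were not positive, [u] would increase at least like
   [- r^(-ell)] near the origin and become negative. *)
Lemma flux_gt_0 (N p R0 : R) (K u w : R -> R) :
  1 < p < N ->
  (forall r, 0 < r < R0 -> 0 < K r) ->
  (forall r, 0 < r < R0 -> 0 < u r) ->
  (forall r, 0 < r < R0 ->
     is_derive u r (- signed_pow (p / (p - 1)) (w r / Rpower r (N - 1)))) ->
  (forall r, 0 < r < R0 ->
     is_derive w r (Rpower r (N - 1) * K r * Rpower (u r) (crit N p - 1))) ->
  forall r, 0 < r < R0 -> 0 < w r.
Proof.
intros Hp HK Hu Hdu Hdw.
assert (Hmon : forall x y, 0 < x -> x < y -> y < R0 -> w x < w y).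
{ intros x y; apply (lt_of_derive_gt_0_open w _ 0 R0 x y Hdw).
  intros s Hs; assert (HKs := HK s Hs); pos. }
intros r Hr; apply Rnot_le_lt; intros Hneg.
set (r1 := r / 2).
set (c := - w r1).
assert (Hc : 0 < c).
{ assert (w r1 < w r) by (apply Hmon; unfold r1; lra); unfold c; lra. }
assert (He := ell_gt_0 N p Hp).
(* With this [k], the derivative of [k r^(-ell)] is [- c^(1/(p-1)) r^(-ell-1)], which [u'] dominates
   on [(0, r1)], where [w < - c]. *)
set (k := Rpower c (1 / (p - 1)) / ell N p).
assert (Hk : 0 < k) by (unfold k; pos).
destruct (Rpower_neg_unbounded (ell N p) k (u r1 + k * Rpower r1 (- ell N p)) r1 He Hk)
  as [s [Hs Hlt]]; [unfold r1; lra|].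
assert (Hle : u s + k * Rpower s (- ell N p) <= u r1 + k * Rpower r1 (- ell N p)).
{ apply (le_of_derive_ge_0 (fun t => u t + k * Rpower t (- ell N p))
   (fun t => - signed_pow (p / (p - 1)) (w t / Rpower t (N - 1))
             + k * (- ell N p * Rpower t (- ell N p - 1)))).
  - lra.
  - intros t Ht; apply is_derive_Rplus; [apply Hdu; unfold r1 in *; lra|].
    apply is_derive_Rscal, is_derive_Rpower; lra.
  - intros t Ht; apply (is_derive_continuous _ _
     (- signed_pow (p / (p - 1)) (w t / Rpower t (N - 1))
             + k * (- ell N p * Rpower t (- ell N p - 1)))).
    apply is_derive_Rplus; [apply Hdu; unfold r1 in *; lra|].
    apply is_derive_Rscal, is_derive_Rpower; lra.
  - intros t Ht.
    assert (Hwt : w t < w r1) by (apply Hmon; unfold r1 in *; lra).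
    rewrite <- signed_pow_opp.
    replace (- (w t / Rpower t (N - 1))) with ((- w t) / Rpower t (N - 1))
      by (unfold Rdiv; ring).
    rewrite flux_power by (unfold c in *; lra).
    replace (k * (- ell N p * Rpower t (- ell N p - 1)))
      with (- (Rpower c (1 / (p - 1)) * Rpower t (- ell N p - 1)))
      by (unfold k; field; lra).
    assert (Rpower c (1 / (p - 1)) * Rpower t (- ell N p - 1) <=
       Rpower (- w t) (1 / (p - 1)) * Rpower t (- ell N p - 1)); [|lra].
    apply Rmult_le_compat_r; [left; apply Rpower_gt_0|].
    apply Rle_Rpower_l; [left; pos | unfold c in *; lra]. }
assert (0 < u s) by (apply Hu; unfold r1 in *; lra).
lra.
Qed.

Lemma profile_of_flux (N p d R0 : R) (K u w : R -> R) :
  1 < p < N ->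
  (forall r, 0 < r < R0 -> 0 < K r) ->
  (forall r, 0 < r < R0 -> 0 < u r) ->
  (forall r, 0 < r < R0 ->
     is_derive u r (- signed_pow (p / (p - 1)) (w r / Rpower r (N - 1)))) ->
  (forall r, 0 < r < R0 ->
     is_derive w r (Rpower r (N - 1) * K r * Rpower (u r) (crit N p - 1))) ->
  filterlim u (at_right 0) (locally d) ->
  profile N p K u w d R0.
Proof.
intros Hp HK Hu Hdu Hdw Hlim.
assert (Hw := flux_gt_0 N p R0 K u w Hp HK Hu Hdu Hdw).
assert (Hdu' : forall r, 0 < r < R0 ->
    is_derive u r (- (Rpower (w r) (1 / (p - 1)) * Rpower r (- ell N p - 1)))).
{ intros r Hr; rewrite <- flux_power; auto; lra. }
assert (Hlim' := filterlim_at_right_0_elim u d Hlim).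
split; auto.
intros r Hr; apply le_epsilon; intros eps He.
destruct (Hlim' eps He) as [delta [Hdelta Hs]].
set (s := Rmin (delta / 2) r).
assert (H1 : s <= delta / 2) by apply Rmin_l.
assert (H2 : s <= r) by apply Rmin_r.
assert (H3 : 0 < s) by (apply Rmin_glb_lt; lra).
specialize (Hs s ltac:(lra)); apply Rabs_lt_between in Hs.
assert (- u s <= - u r); [|lra].
apply (le_of_derive_ge_0_open (fun t => - u t)
  (fun t => - - (Rpower (w t) (1 / (p - 1)) * Rpower t (- ell N p - 1))) 0 R0); try lra.
- intros t Ht; apply is_derive_Ropp; auto.
- intros t Ht; rewrite Ropp_involutive; left; pos.
Qed.

(* A flux bounded away from [0] near the origin would again force [u] to grow
   like [r^(-ell)]. *)
Lemma profile_flux_small (N p d R0 : R) (K u w : R -> R) :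
  1 < p < N -> profile N p K u w d R0 ->
  forall c r, 0 < c -> 0 < r < R0 -> exists s, 0 < s < r /\ w s <= c.
Proof.
intros Hp [Hu Hw Hdu Hdw Hlim Hud] c r Hc Hr.
destruct (classic (exists s, 0 < s < r /\ w s <= c)) as [Hex | Hnex]; [exact Hex | exfalso].
assert (Hwc : forall s, 0 < s < r -> c < w s).
{ intros s Hs; apply Rnot_le_lt; intros Hle; apply Hnex; exists s; split; assumption. }
assert (He := ell_gt_0 N p Hp).
set (k := Rpower c (1 / (p - 1)) / ell N p).
assert (Hk : 0 < k) by (unfold k; pos).
set (r1 := r / 2).
destruct (Rpower_neg_unbounded (ell N p) k (d + k * Rpower r1 (- ell N p)) r1 He Hk)
  as [s [Hs Hlt]]; [unfold r1; lra|].
assert (Hle : k * Rpower s (- ell N p) - u s <= k * Rpower r1 (- ell N p) - u r1).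
{ apply (le_of_derive_ge_0_open (fun t => k * Rpower t (- ell N p) - u t)
   (fun t => k * (- ell N p * Rpower t (- ell N p - 1))
       - - (Rpower (w t) (1 / (p - 1)) * Rpower t (- ell N p - 1))) 0 r);
    try (unfold r1 in *; lra).
  - intros t Ht; apply is_derive_Rminus; [|apply Hdu; lra].
    apply is_derive_Rscal, is_derive_Rpower; lra.
  - intros t Ht.
    replace (k * (- ell N p * Rpower t (- ell N p - 1)))
      with (- (Rpower c (1 / (p - 1)) * Rpower t (- ell N p - 1)))
      by (unfold k; field; lra).
    assert (Rpower c (1 / (p - 1)) * Rpower t (- ell N p - 1) <=
       Rpower (w t) (1 / (p - 1)) * Rpower t (- ell N p - 1)); [|lra].
    apply Rmult_le_compat_r; [left; apply Rpower_gt_0|].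
    apply Rle_Rpower_l; [left; pos | specialize (Hwc t Ht); lra]. }
assert (u s <= d) by (apply Hud; unfold r1 in *; lra).
assert (0 < u r1) by (apply Hu; unfold r1 in *; lra).
lra.
Qed.

(** [M r^N] grows at least as fast as [w] because [N > 1]. The comparison starts at a radius where
    [w <= eps]. *)
Lemma profile_flux_le (N p d KM R0 : R) (K u w : R -> R) :
  1 < p < N -> profile N p K u w d R0 ->
  (forall r, 0 < r < R0 -> 0 < K r <= KM) ->
  forall r, 0 < r < R0 -> w r <= KM * Rpower d (crit N p - 1) * Rpower r N.
Proof.
intros Hp H HK r Hr.
assert (H' := H); destruct H' as [Hu Hw Hdu Hdw Hlim Hud].
apply le_epsilon; intros eps He.
destruct (profile_flux_small N p d R0 K u w Hp H eps r He Hr) as [s [Hs Hws]].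
set (M := KM * Rpower d (crit N p - 1)).
assert (Hle : M * Rpower s N - w s <= M * Rpower r N - w r).
{ apply (le_of_derive_ge_0_open (fun t => M * Rpower t N - w t)
   (fun t => M * (N * Rpower t (N - 1))
       - Rpower t (N - 1) * K t * Rpower (u t) (crit N p - 1)) 0 R0); try lra.
  - intros t Ht; apply is_derive_Rminus; [|apply Hdw; lra].
    apply is_derive_Rscal, is_derive_Rpower; lra.
  - intros t Ht.
    assert (HKt := HK t Ht); assert (Hut := Hu t Ht); assert (Hudt := Hud t Ht).
    assert (Hq := crit_gt N p Hp).
    assert (Hpow : Rpower (u t) (crit N p - 1) <= Rpower d (crit N p - 1))
      by (apply Rle_Rpower_l; lra).
    assert (H1 := Rpower_gt_0 (u t) (crit N p - 1)).
    assert (H2 : K t * Rpower (u t) (crit N p - 1) <= M)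
      by (apply Rmult_le_compat; lra).
    assert (H3 := Rpower_gt_0 t (N - 1)).
    assert (H4 : 0 < K t * Rpower (u t) (crit N p - 1)) by pos.
    assert (H5 : M <= M * N) by nra.
    assert (Rpower t (N - 1) * (K t * Rpower (u t) (crit N p - 1)) <=
       Rpower t (N - 1) * (M * N)) by (apply Rmult_le_compat_l; lra).
    lra. }
assert (0 < M * Rpower s N); [|lra].
assert (0 < d) by (apply Rlt_le_trans with (u r); auto).
specialize (HK r Hr); unfold M; pos.
Qed.

(** * The Pohozaev functional *)

Definition pohozaev (N p : R) (K u w : R -> R) (r : R) : R :=
  (p - 1) / p * (Rpower (w r) (p / (p - 1)) * Rpower r (- ell N p))
  - N / crit N p * (w r * u r)
  + / crit N p * (K r * Rpower r N * Rpower (u r) (crit N p)).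

Lemma Rpower_split (x a b : R) : 0 < x -> a = b + 1 -> Rpower x a = x * Rpower x b.
Proof. intros Hx ->; rewrite Rpower_plus, Rpower_1 by exact Hx; ring. Qed.

Lemma is_derive_pohozaev (N p d R0 : R) (K dK u w : R -> R) :
  1 < p < N -> profile N p K u w d R0 ->
  (forall r, 0 < r < R0 -> is_derive K r (dK r)) ->
  forall r, 0 < r < R0 ->
  is_derive (pohozaev N p K u w) r
    (/ crit N p * (dK r * Rpower r N * Rpower (u r) (crit N p))).
Proof.
intros Hp [Hu Hw Hdu Hdw Hlim Hud] HK r Hr.
assert (Hur := Hu r Hr); assert (Hwr := Hw r Hr).
assert (Hq := crit_gt N p Hp).
evar_last.
{ apply is_derive_Rplus; [apply is_derive_Rminus|]; apply is_derive_Rscal.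
  - apply is_derive_Rmult; [apply is_derive_Rpower_comp; [exact Hwr | apply Hdw, Hr]|].
    apply is_derive_Rpower; lra.
  - apply is_derive_Rmult; [apply Hdw, Hr | apply Hdu, Hr].
  - apply is_derive_Rmult.
    + apply is_derive_Rmult; [apply HK, Hr | apply is_derive_Rpower; lra].
    + apply is_derive_Rpower_comp; [exact Hur | apply Hdu, Hr]. }
(* All powers are reduced to the four occurring in the system; once these are generalized, the
   identity is rational and [field] decides it. *)
cbv beta; rewrite (Rpower_split (w r) (p / (p - 1)) (1 / (p - 1))) by (try field; lra).
replace (p / (p - 1) - 1) with (1 / (p - 1)) by (field; lra).
rewrite (Rpower_split r (- ell N p) (- ell N p - 1)) by lra.
rewrite (Rpower_split r N (N - 1)) by lra.
rewrite (Rpower_split (u r) (crit N p) (crit N p - 1)) by lra.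
generalize (Rpower (w r) (1 / (p - 1))) (Rpower r (- ell N p - 1))
  (Rpower r (N - 1)) (Rpower (u r) (crit N p - 1)).
intros; unfold crit, ell; field; lra.
Qed.

Lemma Rpower_le_scale (a b r R0 : R) : 0 <= b -> 0 < r < R0 ->
  Rpower r (a + b) <= Rpower R0 b * Rpower r a.
Proof.
intros Hb Hr; rewrite Rpower_plus, Rmult_comm.
apply Rmult_le_compat_r; [left; apply Rpower_gt_0 | apply Rle_Rpower_l; lra].
Qed.

(** The only negative term contains [w u], which is [O(r^N)] by the flux bound. This is the form in
    which P(0+) = 0 enters a comparison from the origin. *)
Lemma pohozaev_ge (N p d KM R0 : R) (K u w : R -> R) :
  1 < p < N -> profile N p K u w d R0 ->
  (forall r, 0 < r < R0 -> 0 < K r <= KM) ->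
  exists C, forall r, 0 < r < R0 -> - (C * Rpower r N) <= pohozaev N p K u w r.
Proof.
intros Hp H HK.
assert (Hwle := profile_flux_le N p d KM R0 K u w Hp H HK).
destruct H as [Hu Hw Hdu Hdw Hlim Hud].
assert (Hq := crit_gt N p Hp).
set (M := KM * Rpower d (crit N p - 1)) in *.
exists (N / crit N p * (M * d)); intros r Hr.
assert (HKr := HK r Hr); assert (Hur := Hu r Hr); assert (Hwr := Hw r Hr).
unfold pohozaev.
assert (0 < (p - 1) / p * (Rpower (w r) (p / (p - 1)) * Rpower r (- ell N p))) by pos.
assert (0 < / crit N p * (K r * Rpower r N * Rpower (u r) (crit N p))) by pos.
assert (w r * u r <= M * Rpower r N * d)
  by (apply Rmult_le_compat; try lra; auto).
assert (0 < N / crit N p) by pos.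
assert (N / crit N p * (w r * u r) <= N / crit N p * (M * Rpower r N * d))
  by (apply Rmult_le_compat_l; lra).
lra.
Qed.

(** In the first term [r] gets the exponent [N p/(p-1) - ell = N + p/(p-1)]; the excess over [N] is
    absorbed in a power of [R0]. *)
Lemma pohozaev_le (N p d KM R0 : R) (K u w : R -> R) :
  1 < p < N -> profile N p K u w d R0 ->
  (forall r, 0 < r < R0 -> 0 < K r <= KM) ->
  exists C, forall r, 0 < r < R0 -> pohozaev N p K u w r <= C * Rpower r N.
Proof.
intros Hp H HK.
assert (Hwle := profile_flux_le N p d KM R0 K u w Hp H HK).
destruct H as [Hu Hw Hdu Hdw Hlim Hud].
assert (Hq := crit_gt N p Hp).
set (M := KM * Rpower d (crit N p - 1)) in *.
exists ((p - 1) / p * (Rpower M (p / (p - 1)) * Rpower R0 (p / (p - 1)))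
  + / crit N p * (KM * Rpower d (crit N p))); intros r Hr.
assert (HKr := HK r Hr); assert (Hur := Hu r Hr); assert (Hwr := Hw r Hr).
assert (Hudr := Hud r Hr).
assert (HM : 0 < M) by (unfold M; pos).
unfold pohozaev.
assert (H1 : Rpower (w r) (p / (p - 1)) * Rpower r (- ell N p) <=
  Rpower M (p / (p - 1)) * Rpower R0 (p / (p - 1)) * Rpower r N).
{ apply Rle_trans with (Rpower (M * Rpower r N) (p / (p - 1)) * Rpower r (- ell N p)).
  - apply Rmult_le_compat_r; [left; apply Rpower_gt_0|].
    apply Rle_Rpower_l; [left; pos | split; auto].
  - replace (Rpower (M * Rpower r N) (p / (p - 1)) * Rpower r (- ell N p))
      with (Rpower M (p / (p - 1)) * Rpower r (N + p / (p - 1)))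
      by (unfold ell; rpower_eq).
    rewrite Rmult_assoc; apply Rmult_le_compat_l; [left; apply Rpower_gt_0|].
    apply Rpower_le_scale; [left; pos | exact Hr]. }
assert (H2 : K r * Rpower r N * Rpower (u r) (crit N p) <=
   KM * Rpower r N * Rpower d (crit N p)).
{ apply Rmult_le_compat; try (left; solve [pos]).
  - apply Rmult_le_compat_r; [left; apply Rpower_gt_0 | lra].
  - apply Rle_Rpower_l; lra. }
assert (H3 : 0 < N / crit N p * (w r * u r)) by pos.
assert (H4 : 0 < (p - 1) / p) by pos.
assert (H5 : 0 < / crit N p) by pos.
apply (Rmult_le_compat_l ((p - 1) / p)) in H1; [|lra].
apply (Rmult_le_compat_l (/ crit N p)) in H2; [|lra].
lra.
Qed.

(** * Lower bound for the Dirichlet radius when [l >= ell] *)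

Lemma continuous_le_left (f : R -> R) (a R0 c : R) :
  a < R0 -> continuous f R0 -> (forall r, a < r < R0 -> f r <= c) -> f R0 <= c.
Proof.
intros Ha Hc Hle; apply le_epsilon; intros eps He.
assert (Hn : locally R0 (fun z => Rabs (f z - f R0) < eps)).
{ apply (Hc (fun z => Rabs (z - f R0) < eps)).
  exists (mkposreal eps He); intros z Hz; exact Hz. }
destruct Hn as [delta Hd].
set (s := Rmax ((a + R0) / 2) (R0 - delta / 2)).
assert (Hdp := cond_pos delta).
assert (H1 : (a + R0) / 2 <= s) by apply Rmax_l.
assert (H2 : R0 - delta / 2 <= s) by apply Rmax_r.
assert (H3 : s < R0) by (apply Rmax_lub_lt; lra).
assert (H4 : Rabs (f s - f R0) < eps).
{ apply Hd; unfold ball; simpl; unfold AbsRing_ball, abs, minus, plus, opp; simpl.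
  apply Rabs_lt_between; lra. }
apply Rabs_lt_between in H4; specialize (Hle s ltac:(lra)); lra.
Qed.

(* Since [u R0 = 0] and the flux is at most [w R0], [u] is below a multiple of
   [r^(-ell)] with the same factor [w(R0)^(1/(p-1))] that appears in the value
   [(p-1)/p w(R0)^(p/(p-1)) R0^(-ell)] of the Pohozaev functional at [R0]. *)
Lemma dirichlet_radius_ge (N p l C1 Km KM d R0 : R) (K dK u w : R -> R) :
  1 < p < N -> ell N p <= l -> 0 < Km -> 0 < C1 -> 0 < R0 ->
  profile N p K u w d R0 ->
  (forall r, 0 < r < R0 -> Km <= K r <= KM) ->
  (forall r, 0 < r < R0 -> is_derive K r (dK r)) ->
  (forall r, 0 < r < R0 -> dK r <= C1 * Rpower r (l - 1)) ->
  continuous u R0 -> continuous w R0 -> u R0 = 0 ->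
  (p - 1) / p <= C1 / (crit N p * Km * ell N p) * Rpower R0 l.
Proof.
intros Hp Hl HKm HC1 HR0 H HK HdK HdKle Hcu Hcw Hu0.
assert (HK' : forall r, 0 < r < R0 -> 0 < K r <= KM)
  by (intros r Hr; specialize (HK r Hr); lra).
assert (He := ell_gt_0 N p Hp).
assert (Hq := crit_gt N p Hp).
assert (HdP := is_derive_pohozaev N p d R0 K dK u w Hp H HdK).
destruct (pohozaev_le N p d KM R0 K u w Hp H HK') as [C HC].
destruct H as [Hu Hw Hdu Hdw Hlim Hud].
assert (Hmon : forall x y, 0 < x -> x <= y -> y < R0 -> w x <= w y).
{ intros x y; apply (le_of_derive_ge_0_open w _ 0 R0 x y Hdw).
  intros s Hs; assert (HKs := HK' s Hs); left; pos. }
assert (HwR : forall r, 0 < r < R0 -> w r <= w R0).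
{ intros r Hr; apply Ropp_le_cancel.
  apply (continuous_le_left (fun t => - w t) r R0); [lra | now apply (continuous_opp w)|].
  intros t Ht; apply Ropp_le_contravar, Hmon; lra. }
set (W := w R0) in *.
assert (HW : 0 < W).
{ apply Rlt_le_trans with (w (R0 / 2)); [apply Hw | apply HwR]; lra. }
set (k := Rpower W (1 / (p - 1)) / ell N p).
assert (Hk : 0 < k) by (unfold k; pos).
assert (Huk : forall r, 0 < r < R0 -> u r <= k * Rpower r (- ell N p)).
{ intros r Hr.
  assert (Hd : forall t, 0 < t < R0 ->
    is_derive (fun t => u t - k * Rpower t (- ell N p)) t
     (- (Rpower (w t) (1 / (p - 1)) * Rpower t (- ell N p - 1))
      - k * (- ell N p * Rpower t (- ell N p - 1)))).
  { intros t Ht; apply is_derive_Rminus; [now apply Hdu|].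
    apply is_derive_Rscal, is_derive_Rpower; lra. }
  assert (u r - k * Rpower r (- ell N p) <= u R0 - k * Rpower R0 (- ell N p)).
  { apply (le_of_derive_ge_0 (fun t => u t - k * Rpower t (- ell N p))
     (fun t => - (Rpower (w t) (1 / (p - 1)) * Rpower t (- ell N p - 1))
      - k * (- ell N p * Rpower t (- ell N p - 1)))); [lra| | |].
    - intros t Ht; apply Hd; lra.
    - intros t Ht; destruct (Rlt_dec t R0) as [Hlt | Hge].
      + eapply is_derive_continuous, Hd; lra.
      + replace t with R0 by lra.
        apply (continuous_minus u (fun t => k * Rpower t (- ell N p))); [exact Hcu|].
        eapply is_derive_continuous, is_derive_Rscal, is_derive_Rpower; exact HR0.
    - intros t Ht.
      replace (k * (- ell N p * Rpower t (- ell N p - 1)))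
       with (- (Rpower W (1 / (p - 1)) * Rpower t (- ell N p - 1)))
       by (unfold k; field; lra).
      assert (Rpower (w t) (1 / (p - 1)) * Rpower t (- ell N p - 1) <=
         Rpower W (1 / (p - 1)) * Rpower t (- ell N p - 1)); [|lra].
      apply Rmult_le_compat_r; [left; apply Rpower_gt_0|].
      apply Rle_Rpower_l; [left; pos|].
      split; [apply Hw | apply HwR]; lra. }
  assert (0 < k * Rpower R0 (- ell N p)) by pos.
  lra. }
(* Chosen so that P' <= c w': one factor [u] of [u^q] is replaced by its bound [k r^(-ell)], and
   [K >= Km] turns the rest into [w']. *)
set (c := / crit N p * C1 * Rpower R0 (l - ell N p) * k / Km).
assert (Hc : 0 < c) by (unfold c; pos).
assert (Hfin : forall r, 0 < r < R0 -> 0 <= c * w r - pohozaev N p K u w r).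
{ intros r Hr.
  apply (ge_0_of_derive_ge_0 (fun r => c * w r - pohozaev N p K u w r)
    (fun r => c * (Rpower r (N - 1) * K r * Rpower (u r) (crit N p - 1))
      - / crit N p * (dK r * Rpower r N * Rpower (u r) (crit N p))) C N R0); [lra| | | |exact Hr].
  - intros s Hs; apply is_derive_Rminus; [|now apply HdP].
    apply is_derive_Rscal, Hdw, Hs.
  - intros s Hs.
    assert (HKs := HK s Hs); assert (Hus := Hu s Hs).
    assert (H1 : dK s * Rpower s N * Rpower (u s) (crit N p) <=
      C1 * Rpower R0 (l - ell N p) * k * (Rpower s (N - 1) * Rpower (u s) (crit N p - 1))).
    { apply Rle_trans with (C1 * Rpower s (l - 1) * Rpower s N * Rpower (u s) (crit N p)).
      - repeat (apply Rmult_le_compat_r; [left; apply Rpower_gt_0|]); auto.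
      - replace (C1 * Rpower s (l - 1) * Rpower s N * Rpower (u s) (crit N p)) with
         (C1 * Rpower s l * u s * (Rpower s (N - 1) * Rpower (u s) (crit N p - 1)))
         by rpower_eq.
        apply Rmult_le_compat_r; [left; pos|].
        rewrite 2!Rmult_assoc; apply Rmult_le_compat_l; [lra|].
        apply Rle_trans with (Rpower s l * (k * Rpower s (- ell N p))).
        + apply Rmult_le_compat_l; [left; apply Rpower_gt_0 | auto].
        + replace (Rpower s l * (k * Rpower s (- ell N p)))
            with (Rpower s (l - ell N p) * k) by rpower_eq.
          apply Rmult_le_compat_r; [lra|].
          (* Here [ell <= l] enters: [r^(l-ell)] is at most [R0^(l-ell)]. *)
          apply Rle_Rpower_l; lra. }
    apply (Rmult_le_compat_l (/ crit N p)) in H1; [|left; pos].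
    assert (H2 : c * Km * (Rpower s (N - 1) * Rpower (u s) (crit N p - 1)) <=
       c * K s * (Rpower s (N - 1) * Rpower (u s) (crit N p - 1))).
    { apply Rmult_le_compat_r; [left; pos|]; apply Rmult_le_compat_l; lra. }
    replace (c * Km) with (/ crit N p * C1 * Rpower R0 (l - ell N p) * k) in H2
      by (unfold c; field; lra).
    lra.
  - intros s Hs; specialize (HC s Hs); assert (Hws := Hw s Hs).
    assert (0 < c * w s) by pos; lra. }
(* Limit of [Hfin] at [R0]: the positive term with [K] is dropped, and the term with [w u] vanishes
   since [u R0 = 0]. *)
assert (Hend : (p - 1) / p * (Rpower W (p / (p - 1)) * Rpower R0 (- ell N p)) <= c * W).
{ assert (Hlim2 : (p - 1) / p * (Rpower W (p / (p - 1)) * Rpower R0 (- ell N p))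
     - N / crit N p * (W * u R0) - c * W <= 0); [|rewrite Hu0 in Hlim2; lra].
  apply (continuous_le_left (fun r =>
    (p - 1) / p * (Rpower (w r) (p / (p - 1)) * Rpower r (- ell N p))
    - N / crit N p * (w r * u r) - c * w r) 0 R0); [lra| |].
  - assert (Hpw : continuous (fun r => Rpower (w r) (p / (p - 1))) R0).
    { apply (continuous_comp w (fun y => Rpower y (p / (p - 1)))); [exact Hcw|].
      eapply is_derive_continuous, is_derive_Rpower; exact HW. }
    assert (Hpr : continuous (fun r => Rpower r (- ell N p)) R0)
      by (eapply is_derive_continuous, is_derive_Rpower; exact HR0).
    apply (continuous_minus (V := R_NormedModule));
      [apply (continuous_minus (V := R_NormedModule))|].
    + apply (continuous_scal_r (V := R_NormedModule) ((p - 1) / p)).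
      now apply (continuous_mult (K := R_AbsRing)).
    + apply (continuous_scal_r (V := R_NormedModule) (N / crit N p)).
      now apply (continuous_mult (K := R_AbsRing)).
    + now apply (continuous_scal_r (V := R_NormedModule) c).
  - intros r Hr; specialize (Hfin r Hr); unfold pohozaev in Hfin.
    assert (HKr := HK' r Hr).
    assert (0 < / crit N p * (K r * Rpower r N * Rpower (u r) (crit N p))) by pos.
    lra. }
(* Both sides scale like [W^(p/(p-1))], as [c] contains [W^(1/(p-1))]; the unknown flux cancels. *)
apply Rmult_le_reg_r with (Rpower W (p / (p - 1)) * Rpower R0 (- ell N p)); [pos|].
eapply Rle_trans; [exact Hend|]; right; unfold c, k.
assert (Hcc := Hq); generalize dependent (crit N p); intros q **.
assert (Hl' : Rpower R0 (l - ell N p) = Rpower R0 l * Rpower R0 (- ell N p))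
  by (rewrite <- Rpower_plus; f_equal; ring).
rewrite Hl'.
rewrite (Rpower_split W (p / (p - 1)) (1 / (p - 1))) by (try field; lra).
field; lra.
Qed.

(** * Positive solutions with large initial value *)

Lemma is_derive_ln_comp (g : R -> R) (x dg : R) :
  0 < g x -> is_derive g x dg -> is_derive (fun s => ln (g s)) x (dg / g x).
Proof.
intros Hg Hd.
evar_last; [apply (is_derive_comp ln g x (/ g x) dg); [|exact Hd]|].
- apply is_derive_Reals, derivable_pt_lim_ln, Hg.
- unfold scal; simpl; unfold mult; simpl; field; lra.
Qed.

Lemma pohozaev_ge_0 (N p d KM R0 : R) (K dK u w : R -> R) :
  1 < p < N -> profile N p K u w d R0 ->
  (forall r, 0 < r < R0 -> 0 < K r <= KM) ->
  (forall r, 0 < r < R0 -> is_derive K r (dK r)) ->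
  (forall r, 0 < r < R0 -> 0 <= dK r) ->
  forall r, 0 < r < R0 -> 0 <= pohozaev N p K u w r.
Proof.
intros Hp H HK HdK HdKp r Hr.
destruct (pohozaev_ge N p d KM R0 K u w Hp H HK) as [C HC].
apply (ge_0_of_derive_ge_0 (pohozaev N p K u w)
  (fun r => / crit N p * (dK r * Rpower r N * Rpower (u r) (crit N p))) C N R0 r); [lra | | | exact HC | exact Hr].
- exact (is_derive_pohozaev N p d R0 K dK u w Hp H HdK).
- intros s Hs; specialize (HdKp s Hs); assert (Hq := crit_gt N p Hp).
  apply Rmult_le_pos; [left; pos|].
  repeat (apply Rmult_le_pos; [|left; apply Rpower_gt_0]); exact HdKp.
Qed.

(* Constant on the solutions [d (1 + c r^(p/(p-1)))^(-(N-p)/p)] of the equation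
   with constant [K]; in general its derivative is [crit * pohozaev / (r w u)]. *)
Definition bubble_ratio (N p : R) (u w : R -> R) (r : R) : R :=
  ln (w r) - N * ln r - N * (p - 1) / (N - p) * ln (u r).

Lemma bubble_ratio_monotone (N p d R0 : R) (K u w : R -> R) :
  1 < p < N -> profile N p K u w d R0 ->
  (forall r, 0 < r < R0 -> 0 <= pohozaev N p K u w r) ->
  forall r s, 0 < r -> r <= s -> s < R0 ->
  bubble_ratio N p u w r <= bubble_ratio N p u w s.
Proof.
intros Hp [Hu Hw Hdu Hdw Hlim Hud] HP r s.
assert (Hq := crit_gt N p Hp).
apply (le_of_derive_ge_0_open (bubble_ratio N p u w)
  (fun t => crit N p * pohozaev N p K u w t / (t * w t * u t))).
- intros t Ht; unfold bubble_ratio.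
  assert (Hut := Hu t Ht); assert (Hwt := Hw t Ht).
  evar_last.
  { apply is_derive_Rminus; [apply is_derive_Rminus|].
    - apply is_derive_ln_comp; [exact Hwt | apply Hdw, Ht].
    - apply is_derive_Rscal, is_derive_Reals, derivable_pt_lim_ln; lra.
    - apply is_derive_Rscal, is_derive_ln_comp; [exact Hut | apply Hdu, Ht]. }
  unfold pohozaev; cbv beta.
  rewrite (Rpower_split (w t) (p / (p - 1)) (1 / (p - 1))) by (try field; lra).
  rewrite (Rpower_split t (- ell N p) (- ell N p - 1)) by lra.
  rewrite (Rpower_split t N (N - 1)) by lra.
  rewrite (Rpower_split (u t) (crit N p) (crit N p - 1)) by lra.
  generalize (Rpower (w t) (1 / (p - 1))) (Rpower t (- ell N p - 1))
    (Rpower t (N - 1)) (Rpower (u t) (crit N p - 1)).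
  intros; unfold crit; field; repeat split; lra.
- intros t Ht; specialize (HP t Ht); specialize (Hu t Ht); specialize (Hw t Ht).
  apply Rmult_le_pos; [apply Rmult_le_pos; lra|].
  left; pos.
Qed.

Lemma le_Rpower_inv (x y a : R) : 0 < x -> 0 < y -> 0 < a ->
  y <= Rpower x (- a) -> x <= Rpower y (- / a).
Proof.
intros Hx Hy Ha H.
replace x with (Rpower (Rpower x (- a)) (- / a)).
- apply Rpower_le_neg; [|lra].
  assert (0 < / a) by pos; lra.
- rewrite Rpower_mult; replace (- a * - / a) with 1 by (field; lra).
  now apply Rpower_1.
Qed.

(** Near [0], [u >= d/2] bounds [w'] below. The radius [delta] depends on the solution but the
    constant does not; monotonicity of [bubble_ratio] later carries the bound to all radii. *)
Lemma profile_flux_ge_near_0 (N p d Km R0 : R) (K u w : R -> R) :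
  1 < p < N -> 0 < R0 -> 0 < Km -> profile N p K u w d R0 ->
  (forall r, 0 < r < R0 -> Km <= K r) ->
  exists delta, 0 < delta <= R0 /\ forall r, 0 < r < delta ->
    Km / N * Rpower (d / 2) (crit N p - 1) * Rpower r N <= w r.
Proof.
intros Hp HR0 HKm [Hu Hw Hdu Hdw Hlim Hud] HK.
assert (Hq := crit_gt N p Hp).
assert (Hd : 0 < d).
{ apply Rlt_le_trans with (u (R0 / 2)); [apply Hu | apply Hud]; lra. }
destruct (Hlim (d / 2)) as [eta [Heta Hs]]; [lra|].
set (delta := Rmin eta R0).
assert (H1 : delta <= eta) by apply Rmin_l.
assert (H2 : delta <= R0) by apply Rmin_r.
assert (H3 : 0 < delta) by (apply Rmin_glb_lt; lra).
exists delta; split; [lra|]; intros r Hr.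
set (c := Km / N * Rpower (d / 2) (crit N p - 1)).
cut (0 <= w r - c * Rpower r N); [lra|].
apply (ge_0_of_derive_ge_0 (fun r => w r - c * Rpower r N)
  (fun r => Rpower r (N - 1) * K r * Rpower (u r) (crit N p - 1)
     - c * (N * Rpower r (N - 1))) c N delta); [lra| | | | exact Hr].
- intros s Hsd; apply is_derive_Rminus; [apply Hdw; lra|].
  apply is_derive_Rscal, is_derive_Rpower; lra.
- intros s Hsd; specialize (Hs s ltac:(lra)); apply Rabs_lt_between in Hs.
  assert (Hpow : Rpower (d / 2) (crit N p - 1) <= Rpower (u s) (crit N p - 1))
    by (apply Rle_Rpower_l; lra).
  assert (HKs := HK s ltac:(lra)).
  assert (H4 := Rpower_gt_0 (d / 2) (crit N p - 1)).
  assert (H5 : Km * Rpower (d / 2) (crit N p - 1) <=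
    K s * Rpower (u s) (crit N p - 1)) by (apply Rmult_le_compat; lra).
  apply (Rmult_le_compat_l (Rpower s (N - 1))) in H5; [|left; apply Rpower_gt_0].
  replace (c * (N * Rpower s (N - 1))) with
    (Rpower s (N - 1) * (Km * Rpower (d / 2) (crit N p - 1))) by (unfold c; field; lra).
  lra.
- intros s Hsd; specialize (Hw s ltac:(lra)); lra.
Qed.

(** The monotone ratio bounds the flux below by [m0 r^N u^(N(p-1)/(N-p))], a separable differential
    inequality for [u]. *)
Lemma profile_decay (N p Km rho r1 : R) :
  1 < p < N -> 0 < Km -> 0 < r1 < rho ->
  exists C, 0 < C /\ forall (d : R) (K u w : R -> R), 0 < d ->
    profile N p K u w d rho ->
    (forall r, 0 < r < rho -> Km <= K r) ->
    (forall r, 0 < r < rho -> 0 <= pohozaev N p K u w r) ->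
    u r1 <= C * Rpower d (- (1 / (p - 1))).
Proof.
intros Hp HKm Hr1.
assert (He := ell_gt_0 N p Hp).
assert (Hq := crit_gt N p Hp).
set (c0 := Km / N * Rpower (/ 2) (crit N p - 1)).
assert (Hc0 : 0 < c0) by (unfold c0; pos).
(* The factor of [k r1^(p/(p-1))], with [k] as below, that is independent of [d]. *)
set (c1 := Rpower c0 (1 / (p - 1)) / ell N p * Rpower r1 (p / (p - 1))).
assert (Hc1 : 0 < c1) by (unfold c1; pos).
exists (Rpower c1 (- / (p / (N - p)))); split; [apply Rpower_gt_0|].
intros d K u w Hd H HK HP.
destruct (profile_flux_ge_near_0 N p d Km rho K u w) as [delta [Hdelta Hwge]]; auto; [lra|].
assert (Hmon := bubble_ratio_monotone N p d rho K u w Hp H HP).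
destruct H as [Hu Hw Hdu Hdw Hlim Hud].
(* The exponent is [(q - 1) - N(p-1)/(N-p)]: the flux bound near [0] divided by the power of
   [u <= d]. *)
set (m0 := c0 * Rpower d (p / (N - p))).
assert (Hm0 : 0 < m0) by (unfold m0; pos).
assert (Hm : forall r, 0 < r < rho ->
   m0 * Rpower r N * Rpower (u r) (N * (p - 1) / (N - p)) <= w r).
{ intros r Hr.
  set (s := Rmin (delta / 2) r).
  assert (H1 : s <= delta / 2) by apply Rmin_l.
  assert (H2 : s <= r) by apply Rmin_r.
  assert (H3 : 0 < s) by (apply Rmin_glb_lt; lra).
  assert (Hus := Hu s ltac:(lra)); assert (Hws := Hw s ltac:(lra)).
  assert (Hur := Hu r Hr); assert (Hwr := Hw r Hr).
  assert (Huds := Hud s ltac:(lra)).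
  assert (Hln : ln m0 <= bubble_ratio N p u w s).
  { specialize (Hwge s ltac:(lra)).
    apply ln_le in Hwge; [|pos].
    apply ln_le in Huds; [|pos].
    apply (Rmult_le_compat_l (N * (p - 1) / (N - p))) in Huds; [|left; pos].
    replace (Km / N * Rpower (d / 2) (crit N p - 1) * Rpower s N) with
      (m0 * Rpower s N * Rpower d (N * (p - 1) / (N - p))) in Hwge
      by (unfold m0, c0, crit; rpower_eq).
    rewrite 2!ln_mult, 2!ln_Rpower in Hwge by pos.
    unfold bubble_ratio; lra. }
  assert (Hsr := Hmon s r H3 H2 ltac:(lra)).
  unfold bubble_ratio in *.
  apply Rnot_lt_le; intros Hlt; apply ln_increasing in Hlt; [|exact Hwr].
  rewrite 2!ln_mult, 2!ln_Rpower in Hlt by pos.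
  lra. }
set (k := Rpower m0 (1 / (p - 1)) / ell N p).
assert (Hk : 0 < k) by (unfold k; pos).
(* [u^(-p/(N-p))] integrates the separable inequality; its positivity serves as the initial
   condition. *)
assert (Hv : 0 <= Rpower (u r1) (- (p / (N - p))) - k * Rpower r1 (p / (p - 1))).
{ apply (ge_0_of_derive_ge_0
    (fun r => Rpower (u r) (- (p / (N - p))) - k * Rpower r (p / (p - 1)))
    (fun r => - (p / (N - p)) * Rpower (u r) (- (p / (N - p)) - 1) *
        - (Rpower (w r) (1 / (p - 1)) * Rpower r (- ell N p - 1))
      - k * (p / (p - 1) * Rpower r (p / (p - 1) - 1)))
    k (p / (p - 1)) rho); [pos | | | | exact Hr1].
  - intros s Hs; apply is_derive_Rminus.
    + apply is_derive_Rpower_comp; auto.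
    + apply is_derive_Rscal, is_derive_Rpower; lra.
  - intros s Hs.
    assert (Hms := Hm s Hs); assert (Hus := Hu s Hs); assert (Hws := Hw s Hs).
    assert (H1 : Rpower (m0 * Rpower s N * Rpower (u s) (N * (p - 1) / (N - p))) (1 / (p - 1))
      <= Rpower (w s) (1 / (p - 1))).
    { apply Rle_Rpower_l; [left; pos|]; split; [pos | exact Hms]. }
    apply (Rmult_le_compat_l
      (p / (N - p) * Rpower (u s) (- (p / (N - p)) - 1) * Rpower s (- ell N p - 1)))
      in H1; [|left; pos].
    replace (k * (p / (p - 1) * Rpower s (p / (p - 1) - 1))) with
      (p / (N - p) * Rpower (u s) (- (p / (N - p)) - 1) * Rpower s (- ell N p - 1) *
       Rpower (m0 * Rpower s N * Rpower (u s) (N * (p - 1) / (N - p))) (1 / (p - 1)));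
      [lra|].
    unfold k.
    replace (Rpower m0 (1 / (p - 1)) / ell N p * (p / (p - 1) * Rpower s (p / (p - 1) - 1)))
     with (p / (N - p) * (Rpower m0 (1 / (p - 1)) * Rpower s (p / (p - 1) - 1)))
     by (unfold ell; field; lra).
    rewrite 2!Rmult_assoc; f_equal; unfold ell; rpower_eq.
  - intros s Hs; assert (0 < Rpower (u s) (- (p / (N - p)))) by apply Rpower_gt_0; lra. }
assert (Hur := Hu r1 Hr1).
assert (Hle : u r1 <= Rpower (k * Rpower r1 (p / (p - 1))) (- / (p / (N - p)))).
{ apply le_Rpower_inv; [exact Hur | pos | pos | lra]. }
eapply Rle_trans; [exact Hle|]; right.
replace (k * Rpower r1 (p / (p - 1))) with (c1 * Rpower d (p / (N - p) * (1 / (p - 1)))).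
- rewrite <- Rpower_mult_distr by pos; rewrite Rpower_mult.
  f_equal; f_equal; field; lra.
- unfold c1, k, m0; rewrite <- Rpower_mult_distr by pos; rewrite Rpower_mult.
  field; lra.
Qed.

(** On [[r1, r2]] the slope [- u'] is bounded below through [w r1], while [u] can lose at most
    [u r1]. So the flux at [r1], and with it the functional, is controlled by a power of [u r1]. *)
Lemma pohozaev_decay (N p Km KM rho r1 : R) :
  1 < p < N -> 0 < Km <= KM -> 0 < r1 < rho ->
  exists C, 0 < C /\ forall (d : R) (K u w : R -> R), 1 <= d ->
    profile N p K u w d rho ->
    (forall r, 0 < r < rho -> Km <= K r <= KM) ->
    (forall r, 0 < r < rho -> 0 <= pohozaev N p K u w r) ->
    pohozaev N p K u w r1 <= C * Rpower d (- (p / (p - 1))).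
Proof.
intros Hp HKm Hr1.
assert (He := ell_gt_0 N p Hp).
assert (Hq := crit_gt N p Hp).
destruct (profile_decay N p Km rho r1 Hp ltac:(lra) Hr1) as [C [HC Hdec]].
set (r2 := (r1 + rho) / 2).
set (c3 := / ((r2 - r1) * Rpower r2 (- ell N p - 1))).
assert (Hc3 : 0 < c3) by (unfold c3, r2; pos).
(* The two terms bound the flux part and the [u^q] part by [u(r1)^p]; the second writes
   [u^q = u^(q-p) u^p] and uses [u r1 <= C], valid for [d >= 1]. *)
set (C4 := (p - 1) / p * (Rpower c3 p * Rpower r1 (- ell N p))
   + / crit N p * (KM * Rpower r1 N * Rpower C (crit N p - p))).
assert (HC4 : 0 < C4).
{ unfold C4; apply Rplus_lt_0_compat; pos. }
exists (C4 * Rpower C p); split; [pos|].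
intros d K u w Hd H HK HP.
specialize (Hdec d K u w ltac:(lra) H (fun r Hr => proj1 (HK r Hr)) HP).
destruct H as [Hu Hw Hdu Hdw Hlim Hud].
assert (Hu1 := Hu r1 Hr1); assert (Hw1 := Hw r1 Hr1); assert (HK1 := HK r1 Hr1).
assert (Hmon : forall x y, 0 < x -> x <= y -> y < rho -> w x <= w y).
{ intros x y; apply (le_of_derive_ge_0_open w _ 0 rho x y Hdw).
  intros s Hs; assert (HKs := HK s Hs); left; pos. }
assert (Hflux : Rpower (w r1) (1 / (p - 1)) <= c3 * u r1).
{ set (a := Rpower (w r1) (1 / (p - 1)) * Rpower r2 (- ell N p - 1)).
  assert (Hle : - u r1 - a * r1 <= - u r2 - a * r2).
  { apply (le_of_derive_ge_0 (fun t => - u t - a * t)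
     (fun t => - - (Rpower (w t) (1 / (p - 1)) * Rpower t (- ell N p - 1)) - a * 1));
      [unfold r2; lra | | |].
    - intros t Ht; apply is_derive_Rminus;
        [apply is_derive_Ropp, Hdu; unfold r2 in *; lra |].
      apply is_derive_Rscal; exact (is_derive_id t).
    - intros t Ht; apply (continuous_minus (V := R_NormedModule)).
      + apply (continuous_opp (V := R_NormedModule)).
        eapply is_derive_continuous, Hdu; unfold r2 in *; lra.
      + apply (continuous_scal_r (V := R_NormedModule) a), continuous_id.
    - intros t Ht; rewrite Ropp_involutive, Rmult_1_r.
      assert (a <= Rpower (w t) (1 / (p - 1)) * Rpower t (- ell N p - 1)); [|lra].
      unfold a; apply Rmult_le_compat; try (left; apply Rpower_gt_0).
      + apply Rle_Rpower_l; [left; pos|]; split; [exact Hw1|].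
        apply Hmon; unfold r2 in *; lra.
      + apply Rpower_le_neg; lra. }
  assert (Hu2 : 0 < u r2) by (apply Hu; unfold r2; lra).
  unfold c3.
  apply Rmult_le_reg_r with ((r2 - r1) * Rpower r2 (- ell N p - 1)); [unfold r2; pos|].
  replace (/ ((r2 - r1) * Rpower r2 (- ell N p - 1)) * u r1 *
    ((r2 - r1) * Rpower r2 (- ell N p - 1))) with (u r1).
  - unfold a in Hle; lra.
  - field; split; [apply Rgt_not_eq, Rpower_gt_0 | unfold r2; lra]. }
assert (Hd1 : Rpower d (- (1 / (p - 1))) <= 1).
{ apply Rle_trans with (Rpower 1 (- (1 / (p - 1)))); [|rewrite Rpower_1_l; lra].
  assert (0 < 1 / (p - 1)) by pos; apply Rpower_le_neg; lra. }
assert (HuC : u r1 <= C).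
{ apply Rle_trans with (1 := Hdec); rewrite <- (Rmult_1_r C) at 2.
  apply Rmult_le_compat_l; lra. }
apply Rle_trans with (C4 * Rpower (u r1) p).
- unfold pohozaev.
  assert (H1 : Rpower (w r1) (p / (p - 1)) <= Rpower c3 p * Rpower (u r1) p).
  { rewrite Rpower_mult_distr by lra.
    replace (Rpower (w r1) (p / (p - 1))) with (Rpower (Rpower (w r1) (1 / (p - 1))) p)
      by (rewrite Rpower_mult; f_equal; field; lra).
    apply Rle_Rpower_l; [lra|]; split; [apply Rpower_gt_0 | exact Hflux]. }
  apply (Rmult_le_compat_r (Rpower r1 (- ell N p))) in H1; [|left; apply Rpower_gt_0].
  apply (Rmult_le_compat_l ((p - 1) / p)) in H1; [|left; pos].
  assert (H2 : K r1 * Rpower r1 N * Rpower (u r1) (crit N p) <=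
     KM * Rpower r1 N * (Rpower C (crit N p - p) * Rpower (u r1) p)).
  { apply Rmult_le_compat; try (left; solve [pos]).
    - apply Rmult_le_compat_r; [left; apply Rpower_gt_0 | lra].
    - replace (crit N p) with (crit N p - p + p) at 1 by ring.
      rewrite Rpower_plus; apply Rmult_le_compat_r; [left; apply Rpower_gt_0|].
      apply Rle_Rpower_l; lra. }
  apply (Rmult_le_compat_l (/ crit N p)) in H2; [|left; pos].
  assert (H3 : 0 < N / crit N p * (w r1 * u r1)) by pos.
  unfold C4; lra.
- rewrite Rmult_assoc; apply Rmult_le_compat_l; [lra|].
  replace (- (p / (p - 1))) with (- (1 / (p - 1)) * p) by (field; lra).
  rewrite <- Rpower_mult, Rpower_mult_distr by pos.
  apply Rle_Rpower_l; [lra|]; split; assumption.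
Qed.

(* [u] stays above [d/2] on the natural length scale [d^(-p/(N-p))] of the
   critical equation. *)
Lemma profile_core (N p KM : R) :
  1 < p < N -> 0 < KM ->
  exists eps, 0 < eps /\ forall (d rho : R) (K u w : R -> R), 0 < d ->
    profile N p K u w d rho ->
    (forall r, 0 < r < rho -> 0 < K r <= KM) ->
    forall r, 0 < r < rho -> r <= eps * Rpower d (- (p / (N - p))) -> d / 2 <= u r.
Proof.
intros Hp HKM.
assert (He := ell_gt_0 N p Hp).
assert (Hq := crit_gt N p Hp).
set (k := Rpower KM (1 / (p - 1))).
assert (Hk : 0 < k) by (unfold k; pos).
(* At [r = eps d^(-p/(N-p))] this makes the maximal loss [M r^(p/(p-1))] of [u] equal to [d/2]. *)
exists (Rpower (/ (2 * k)) ((p - 1) / p)); split; [apply Rpower_gt_0|].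
intros d rho K u w Hd H HK r Hr Hre.
assert (Hwle := profile_flux_le N p d KM rho K u w Hp H HK).
destruct H as [Hu Hw Hdu Hdw Hlim Hud].
set (M := k * Rpower d ((crit N p - 1) * (1 / (p - 1)))).
assert (HM : 0 < M) by (unfold M; pos).
assert (Hlow : d <= u r + M * Rpower r (p / (p - 1))).
{ apply le_epsilon; intros e Hepos.
  destruct (Hlim e Hepos) as [eta [Heta Hs]].
  set (s := Rmin (eta / 2) r).
  assert (H1 : s <= eta / 2) by apply Rmin_l.
  assert (H2 : s <= r) by apply Rmin_r.
  assert (H3 : 0 < s) by (apply Rmin_glb_lt; lra).
  specialize (Hs s ltac:(lra)); apply Rabs_lt_between in Hs.
  assert (u s + M * Rpower s (p / (p - 1)) <= u r + M * Rpower r (p / (p - 1))).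
  { apply (le_of_derive_ge_0_open (fun t => u t + M * Rpower t (p / (p - 1)))
     (fun t => - (Rpower (w t) (1 / (p - 1)) * Rpower t (- ell N p - 1))
       + M * (p / (p - 1) * Rpower t (p / (p - 1) - 1))) 0 rho); try lra.
    - intros t Ht; apply is_derive_Rplus; [now apply Hdu|].
      apply is_derive_Rscal, is_derive_Rpower; lra.
    - intros t Ht.
      assert (H4 : Rpower (w t) (1 / (p - 1)) <=
         Rpower (KM * Rpower d (crit N p - 1) * Rpower t N) (1 / (p - 1))).
      { apply Rle_Rpower_l; [left; pos|]; split; auto. }
      apply (Rmult_le_compat_r (Rpower t (- ell N p - 1))) in H4;
        [|left; apply Rpower_gt_0].
      replace (Rpower (KM * Rpower d (crit N p - 1) * Rpower t N) (1 / (p - 1)) *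
        Rpower t (- ell N p - 1)) with (M * Rpower t (p / (p - 1) - 1)) in H4
        by (unfold M, k, ell; rpower_eq).
      assert (H5 : 1 <= p / (p - 1)).
      { apply Rmult_le_reg_r with (p - 1); [lra|]; unfold Rdiv;
        rewrite Rmult_assoc, Rinv_l; lra. }
      assert (H6 : 0 < M * Rpower t (p / (p - 1) - 1)) by pos.
      nra. }
  assert (0 < M * Rpower s (p / (p - 1))) by pos.
  lra. }
assert (Hpow : Rpower r (p / (p - 1)) <=
   Rpower (Rpower (/ (2 * k)) ((p - 1) / p) * Rpower d (- (p / (N - p)))) (p / (p - 1))).
{ apply Rle_Rpower_l; [left; pos | lra]. }
apply (Rmult_le_compat_l M) in Hpow; [|lra].
replace (M * Rpower (Rpower (/ (2 * k)) ((p - 1) / p) * Rpower d (- (p / (N - p)))) (p / (p - 1)))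
  with (d / 2) in Hpow; [lra|].
rewrite <- Rpower_mult_distr, Rpower_mult by pos.
replace ((p - 1) / p * (p / (p - 1))) with 1 by (field; lra).
rewrite Rpower_1 by pos.
unfold M; generalize k, Hk; intros k' Hk'; unfold crit; rpower_eq.
Qed.

(** On the core, [u >= d/2] bounds P' below by a multiple of [d^q r^(N+l-1)]. Integration up to half
    the core radius yields the power [q - p(N+l)/(N-p) = - p l/(N-p)] of [d], and P is nondecreasing
    afterwards. *)
Lemma pohozaev_growth (N p l c1 KM rho r1 : R) :
  1 < p < N -> 0 < l -> 0 < c1 -> 0 < KM -> 0 < r1 < rho ->
  exists c D, 0 < c /\ 0 < D /\ forall (d : R) (K dK u w : R -> R), D <= d ->
    profile N p K u w d rho ->
    (forall r, 0 < r < rho -> 0 < K r <= KM) ->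
    (forall r, 0 < r < rho -> is_derive K r (dK r)) ->
    (forall r, 0 < r < rho -> c1 * Rpower r (l - 1) <= dK r) ->
    c * Rpower d (- (p / (N - p) * l)) <= pohozaev N p K u w r1.
Proof.
intros Hp Hl Hc1 HKM Hr1.
assert (Hq := crit_gt N p Hp).
destruct (profile_core N p KM Hp HKM) as [eps [Heps Hcore]].
set (a := p / (N - p)).
assert (Ha : 0 < a) by (unfold a; pos).
exists (/ crit N p * c1 * Rpower (/ 2) (crit N p) / (N + l) * Rpower (eps / 2) (N + l)).
(* From this value of [d] on, the core radius [r0] is at most [r1]. *)
exists (Rpower (r1 / eps) (- / a)).
split; [pos|]; split; [pos|].
intros d K dK u w Hd H HK HdK HdKge.
assert (Hd0 : 0 < d) by (eapply Rlt_le_trans; [|exact Hd]; pos).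
set (r0 := eps * Rpower d (- a)).
assert (Hr0 : 0 < r0) by (unfold r0; pos).
assert (Hr0' : r0 <= r1).
{ unfold r0.
  assert (Rpower d (- a) <= Rpower (Rpower (r1 / eps) (- / a)) (- a))
    by (apply Rpower_le_neg; [lra | split; [apply Rpower_gt_0 | exact Hd]]).
  rewrite Rpower_mult in H0; replace (- / a * - a) with 1 in H0 by (field; lra).
  rewrite Rpower_1 in H0 by pos.
  apply (Rmult_le_compat_l eps) in H0; [|lra].
  replace (eps * (r1 / eps)) with r1 in H0 by (field; lra); exact H0. }
specialize (Hcore d rho K u w Hd0 H HK).
assert (HdP := is_derive_pohozaev N p d rho K dK u w Hp H HdK).
destruct (pohozaev_ge N p d KM rho K u w Hp H HK) as [C HC].
destruct H as [Hu Hw Hdu Hdw Hlim Hud].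
set (c := / crit N p * c1 * Rpower (d / 2) (crit N p) / (N + l)).
assert (Hc : 0 < c) by (unfold c; pos).
apply Rle_trans with (pohozaev N p K u w (r0 / 2)).
- assert (Hge : 0 <= pohozaev N p K u w (r0 / 2) - c * Rpower (r0 / 2) (N + l)).
  { apply (ge_0_of_derive_ge_0 (fun r => pohozaev N p K u w r - c * Rpower r (N + l))
     (fun r => / crit N p * (dK r * Rpower r N * Rpower (u r) (crit N p))
        - c * ((N + l) * Rpower r (N + l - 1)))
     (* The second summand comes from [c r^(N+l) <= c r0^l r^N]. *)
     (C + c * Rpower r0 l) N r0); [lra | | | | lra].
    - intros s Hs; apply is_derive_Rminus; [apply HdP; lra|].
      apply is_derive_Rscal, is_derive_Rpower; lra.
    - intros s Hs.
      assert (Hus := Hcore s ltac:(lra)).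
      fold a r0 in Hus; specialize (Hus ltac:(lra)).
      assert (HdKs := HdKge s ltac:(lra)).
      assert (H1 : Rpower (d / 2) (crit N p) <= Rpower (u s) (crit N p))
        by (apply Rle_Rpower_l; lra).
      assert (H2 : c1 * Rpower s (l - 1) * Rpower s N * Rpower (d / 2) (crit N p) <=
        dK s * Rpower s N * Rpower (u s) (crit N p)).
      { apply Rmult_le_compat; try (left; solve [pos]); [|exact H1].
        apply Rmult_le_compat_r; [left; apply Rpower_gt_0 | exact HdKs]. }
      apply (Rmult_le_compat_l (/ crit N p)) in H2; [|left; pos].
      replace (c * ((N + l) * Rpower s (N + l - 1))) with
       (/ crit N p * (c1 * Rpower s (l - 1) * Rpower s N * Rpower (d / 2) (crit N p)));
       [lra|].
      replace (Rpower s (N + l - 1)) with (Rpower s (l - 1) * Rpower s N)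
        by (rewrite <- Rpower_plus; f_equal; ring).
      unfold c; field; lra.
    - intros s Hs; specialize (HC s ltac:(lra)).
      assert (H1 := Rpower_le_scale N l s r0 ltac:(lra) Hs).
      apply (Rmult_le_compat_l c) in H1; lra. }
  eapply Rle_trans; [|apply Rminus_le_0 in Hge; exact Hge].
  right; unfold c, r0.
  assert (Hcq : crit N p = a * N) by (unfold a, crit; field; lra).
  assert (Hcq' : 0 < a * N) by pos.
  rewrite Hcq; generalize a, Ha, Hcq'; intros a' Ha' Hcq''; rpower_eq.
- apply (le_of_derive_ge_0_open (pohozaev N p K u w)
   (fun r => / crit N p * (dK r * Rpower r N * Rpower (u r) (crit N p))) 0 rho);
   try lra; [exact HdP|].
  intros s Hs; specialize (HdKge s Hs).
  assert (0 < c1 * Rpower s (l - 1)) by pos.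
  left; pos.
Qed.

Lemma no_large_profile (N p l c1 Km KM rho : R) :
  1 < p < N -> 0 < l < ell N p -> 0 < c1 -> 0 < Km <= KM -> 0 < rho ->
  exists D, 0 < D /\ forall (d : R) (K dK u w : R -> R), D <= d ->
    profile N p K u w d rho ->
    (forall r, 0 < r < rho -> Km <= K r <= KM) ->
    (forall r, 0 < r < rho -> is_derive K r (dK r)) ->
    (forall r, 0 < r < rho -> c1 * Rpower r (l - 1) <= dK r) -> False.
Proof.
intros Hp Hl Hc1 HKm Hrho.
assert (Hr1 : 0 < rho / 2 < rho) by lra.
destruct (pohozaev_decay N p Km KM rho (rho / 2) Hp HKm Hr1) as [C [HC Hup]].
destruct (pohozaev_growth N p l c1 KM rho (rho / 2) Hp ltac:(lra) Hc1 ltac:(lra) Hr1)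
  as [c [D1 [Hc [HD1 Hlow]]]].
(* [b = p/(N-p) (ell - l)]: the upper bound decays faster than the lower one exactly when
   [l < ell]. *)
set (b := p / (p - 1) - p / (N - p) * l).
assert (Hb : 0 < b).
{ unfold b; replace (p / (p - 1)) with (p / (N - p) * ell N p)
    by (unfold ell; field; lra).
  assert (0 < p / (N - p)) by pos; nra. }
(* Ensures [c d^b >= C + 1], against [c d^b <= C] from the two bounds. *)
set (D2 := Rpower ((C + 1) / c) (/ b)).
exists (Rmax 1 (Rmax D1 D2)); split.
{ apply Rlt_le_trans with 1; [lra | apply Rmax_l]. }
intros d K dK u w Hd H HK HdK HdKge.
assert (Hd1 : 1 <= d) by (eapply Rle_trans; [apply Rmax_l | exact Hd]).
assert (Hd2 : Rmax D1 D2 <= d) by (eapply Rle_trans; [apply Rmax_r | exact Hd]).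
assert (Hd3 : D1 <= d) by (eapply Rle_trans; [apply Rmax_l | exact Hd2]).
assert (Hd4 : D2 <= d) by (eapply Rle_trans; [apply Rmax_r | exact Hd2]).
assert (HK' : forall r, 0 < r < rho -> 0 < K r <= KM)
  by (intros r Hr; specialize (HK r Hr); lra).
assert (HP : forall r, 0 < r < rho -> 0 <= pohozaev N p K u w r).
{ apply (pohozaev_ge_0 N p d KM rho K dK u w Hp H HK' HdK).
  intros r Hr; specialize (HdKge r Hr).
  assert (0 < c1 * Rpower r (l - 1)) by pos; lra. }
specialize (Hup d K u w Hd1 H HK HP).
specialize (Hlow d K dK u w Hd3 H HK' HdK HdKge).
assert (Hpow : (C + 1) / c <= Rpower d b).
{ replace ((C + 1) / c) with (Rpower D2 b).
  - apply Rle_Rpower_l; [lra|]; split; [apply Rpower_gt_0 | exact Hd4].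
  - unfold D2; rewrite Rpower_mult, Rinv_l, Rpower_1 by pos; reflexivity. }
assert (Hfin : c * Rpower d (- (p / (N - p) * l)) <= C * Rpower d (- (p / (p - 1)))) by lra.
apply (Rmult_le_compat_r (Rpower d (p / (p - 1)))) in Hfin; [|left; apply Rpower_gt_0].
rewrite 2!Rmult_assoc, <- 2!Rpower_plus in Hfin.
replace (- (p / (p - 1)) + p / (p - 1)) with 0 in Hfin by ring.
replace (- (p / (N - p) * l) + p / (p - 1)) with b in Hfin by (unfold b; ring).
rewrite Rpower_O in Hfin by lra.
apply (Rmult_le_compat_l c) in Hpow; [|lra].
replace (c * ((C + 1) / c)) with (C + 1) in Hpow by (field; lra).
lra.
Qed.

(** * From the equation to the system *)

Lemma filterlim_within_elim (f : R -> R) (D : R -> Prop) (x y : R) :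
  filterlim f (within D (locally x)) (locally y) ->
  forall eps, 0 < eps -> exists delta, 0 < delta /\
    forall s, Rabs (s - x) < delta -> D s -> Rabs (f s - y) < eps.
Proof.
intros H eps He.
assert (Hn : within D (locally x) (fun s => Rabs (f s - y) < eps)).
{ apply (H (fun z => Rabs (z - y) < eps)).
  exists (mkposreal eps He); intros z Hz; exact Hz. }
destruct Hn as [delta Hd].
exists delta; split; [apply cond_pos|].
intros s Hs HD; apply Hd; assumption.
Qed.

Lemma C1_halfline_derive (f : R -> R) :
  C1_halfline f -> forall r, 0 < r -> ex_derive f r.
Proof.
intros [f' H] r Hr; exists (f' r).
apply is_derive_Reals; intros eps He.
destruct (filterlim_within_elim _ _ _ _ (proj1 (H r (Rlt_le _ _ Hr))) eps He)
  as [delta [Hdelta Hs]].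
assert (Hm : 0 < Rmin delta r) by (apply Rmin_glb_lt; lra).
exists (mkposreal _ Hm); simpl; intros t Ht Htm.
assert (H1 := Rmin_l delta r); assert (H2 := Rmin_r delta r).
specialize (Hs (r + t)).
replace (r + t - r) with t in Hs by ring.
apply Hs; [lra|].
apply Rabs_lt_between in Htm; lra.
Qed.

Lemma C1_halfline_continuous (f : R -> R) (r : R) :
  C1_halfline f -> 0 <= r -> forall eps, 0 < eps -> exists delta, 0 < delta /\
    forall s, 0 <= s -> Rabs (s - r) < delta -> Rabs (f s - f r) < eps.
Proof.
intros [f' H] Hr eps He.
destruct (filterlim_within_elim _ _ _ _ (proj1 (H r Hr)) 1 Rlt_0_1)
  as [delta [Hdelta Hs]].
set (M := Rabs (f' r) + 1).
assert (HM : 1 <= M) by (assert (H0 := Rabs_pos (f' r)); unfold M; lra).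
exists (Rmin delta (eps / M)); split; [apply Rmin_glb_lt; [lra | pos]|].
intros s Hs0 Hsr.
assert (H1 := Rmin_l delta (eps / M)); assert (H2 := Rmin_r delta (eps / M)).
destruct (Req_dec s r) as [-> | Hne].
{ unfold Rminus; rewrite Rplus_opp_r, Rabs_R0; exact He. }
specialize (Hs s ltac:(lra) (conj Hs0 Hne)).
assert (Hq : Rabs ((f s - f r) / (s - r)) < M).
{ assert (H3 := Rabs_triang ((f s - f r) / (s - r) - f' r) (f' r)).
  replace ((f s - f r) / (s - r) - f' r + f' r) with ((f s - f r) / (s - r)) in H3 by ring.
  unfold M; lra. }
replace (f s - f r) with ((f s - f r) / (s - r) * (s - r)) by (field; lra).
rewrite Rabs_mult.
assert (Hsp : 0 < Rabs (s - r)) by (apply Rabs_pos_lt; lra).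
apply Rlt_le_trans with (M * Rabs (s - r)); [apply Rmult_lt_compat_r; lra|].
apply Rle_trans with (M * (eps / M)); [apply Rmult_le_compat_l; lra|].
right; field; lra.
Qed.

Lemma weight_near_0 (K h : R -> R) (A B l : R) :
  C1_halfline K -> 0 < A -> 0 < B -> 0 < l ->
  (forall r, 0 <= r -> K r = A + B * rpow r l + h r) ->
  filterlim (fun r => (Rabs (h r) + r * Rabs (Derive h r)) / rpow r l)
    (at_right 0) (locally 0) ->
  exists rho, 0 < rho /\ forall r, 0 < r < rho ->
    A / 2 <= K r <= 2 * A /\ is_derive K r (Derive K r) /\
    B * l / 2 * Rpower r (l - 1) <= Derive K r <= 2 * (B * l) * Rpower r (l - 1).
Proof.
intros HC1 HA HB Hl HK Hh.
assert (HBl : 0 < B * l / 2) by pos.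
(* With this tolerance [h'] removes at most half of the leading term [B l r^(l-1)] of [K']. *)
destruct (filterlim_at_right_0_elim _ _ Hh (B * l / 2) HBl) as [d1 [Hd1 Hs]].
destruct (Rpower_small l (B + B * l / 2) (A / 2) Hl) as [d2 [Hd2 Hs2]]; [lra|].
exists (Rmin d1 d2); split; [apply Rmin_glb_lt; lra|].
intros r Hr.
assert (H1 := Rmin_l d1 d2); assert (H2 := Rmin_r d1 d2).
specialize (Hs r ltac:(lra)); specialize (Hs2 r ltac:(lra)).
assert (Hrp : forall s, 0 < s -> rpow s l = Rpower s l).
{ intros s Hsp; unfold rpow; destruct (Rlt_dec 0 s); [reflexivity | lra]. }
rewrite Hrp, Rminus_0_r in Hs by lra.
assert (Hp := Rpower_gt_0 r l).
assert (Hsum : Rabs (h r) + r * Rabs (Derive h r) <= B * l / 2 * Rpower r l).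
{ apply Rabs_lt_between in Hs.
  apply Rmult_le_reg_r with (/ Rpower r l); [pos|].
  rewrite Rmult_assoc, Rinv_r by lra; unfold Rdiv in Hs at 3; lra. }
assert (Hh0 := Rabs_pos (h r)); assert (Hdh0 := Rabs_pos (Derive h r)).
assert (Hrdh : 0 <= r * Rabs (Derive h r)) by (apply Rmult_le_pos; lra).
assert (Hhr : Rabs (h r) <= B * l / 2 * Rpower r l) by lra.
assert (Hdh : Rabs (Derive h r) <= B * l / 2 * Rpower r (l - 1)).
{ apply Rmult_le_reg_l with r; [lra|].
  rewrite (Rpower_split r l (l - 1)) in Hsum by lra; lra. }
apply Rabs_le_between in Hhr; apply Rabs_le_between in Hdh.
assert (HdK : is_derive K r (Derive K r))
  by (apply Derive_correct, C1_halfline_derive; [exact HC1 | lra]).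
(* [Derive h] is meaningful only once [h] is differentiable; this follows from [h = K - A - B r^l]
   near [r > 0]. *)
assert (Hdh' : is_derive h r (Derive K r - B * (l * Rpower r (l - 1)))).
{ apply (is_derive_ext_loc (fun s => K s - A - B * Rpower s l)).
  - exists (mkposreal r (proj1 Hr)); intros s Hsr.
    unfold ball in Hsr; simpl in Hsr;
      unfold AbsRing_ball, abs, minus, plus, opp in Hsr; simpl in Hsr.
    apply Rabs_lt_between in Hsr.
    rewrite HK, Hrp by lra; lra.
  - apply is_derive_Rminus; [|apply is_derive_Rscal, is_derive_Rpower; lra].
    rewrite <- (Rminus_0_r (Derive K r)) at 1.
    apply is_derive_Rminus; [exact HdK | exact (is_derive_const A r)]. }
apply is_derive_unique in Hdh'.
rewrite Hdh' in Hdh.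
split; [|split; [exact HdK|]].
- rewrite HK, Hrp by lra.
  assert (0 < B * Rpower r l) by pos; lra.
- assert (Hp1 := Rpower_gt_0 r (l - 1)); nra.
Qed.

(** The flux [w], signed so as to be positive for decreasing [u]; no absolute value is taken, since
    monotonicity is not yet known. *)
Definition radial_flux (n : nat) (p : R) (u : R -> R) (r : R) : R :=
  - (r ^ (n - 1) * signed_pow p (Derive u r)).

Lemma INR_minus_1 (n : nat) (p : R) : 1 < p < INR n -> INR (n - 1) = INR n - 1.
Proof.
intros Hp; rewrite minus_INR; [reflexivity|].
apply INR_le; change (INR 1) with 1; lra.
Qed.

Lemma pow_Rpower (n : nat) (p r : R) : 1 < p < INR n -> 0 < r ->
  r ^ (n - 1) = Rpower r (INR n - 1).
Proof. intros Hp Hr; rewrite <- Rpower_pow by exact Hr; now rewrite (INR_minus_1 n p Hp). Qed.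

Lemma radial_ode_system (n : nat) (p : R) (K u : R -> R) (r : R) :
  1 < p < INR n -> 0 < r -> radial_ode n p K u r ->
  is_derive u r
    (- signed_pow (p / (p - 1)) (radial_flux n p u r / Rpower r (INR n - 1))) /\
  is_derive (radial_flux n p u) r
    (Rpower r (INR n - 1) * K r * signed_pow (crit (INR n) p) (u r)).
Proof.
intros Hp Hr [Hu [Hfl Heq]]; split.
- evar_last; [apply Derive_correct, Hu|].
  unfold radial_flux; rewrite (pow_Rpower n p r Hp Hr).
  assert (H := Rpower_gt_0 r (INR n - 1)).
  replace (- (Rpower r (INR n - 1) * signed_pow p (Derive u r)) / Rpower r (INR n - 1))
    with (- signed_pow p (Derive u r)) by (field; lra).
  rewrite signed_pow_opp, signed_pow_conj; lra.
- evar_last; [apply is_derive_Ropp, Derive_correct, Hfl|].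
  rewrite <- (pow_Rpower n p r Hp Hr); symmetry; exact (Rplus_opp_r_uniq _ _ Heq).
Qed.

Lemma profile_of_regular (n : nat) (p d T R0 : R) (K u : R -> R) :
  1 < p < INR n -> R0 <= T ->
  (forall r, 0 < r < R0 -> 0 < K r) ->
  (forall r, 0 < r < R0 -> 0 < u r) ->
  regular_solution n p K d T u ->
  profile (INR n) p K u (radial_flux n p u) d R0.
Proof.
intros Hp HT HK Hu [_ [Hlim Hode]].
assert (Hsys := fun r (Hr : 0 < r < R0) => radial_ode_system n p K u r Hp (proj1 Hr)
  (Hode r (conj (proj1 Hr) (Rlt_le_trans _ _ _ (proj2 Hr) HT)))).
apply profile_of_flux; auto.
- intros r Hr; apply Hsys, Hr.
- intros r Hr; rewrite <- (signed_pow_pos _ (u r)) by auto; apply Hsys, Hr.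
Qed.

(** * Nonexistence in small balls and for large initial values *)

Lemma no_radial_solution_small_ball (n : nat) (p : R) (K h : R -> R) (A B l : R) :
  1 < p < INR n -> C1_halfline K -> 0 < A -> 0 < B -> 0 < l ->
  (forall r, 0 <= r -> K r = A + B * rpow r l + h r) ->
  filterlim (fun r => (Rabs (h r) + r * Rabs (Derive h r)) / rpow r l)
    (at_right 0) (locally 0) ->
  ell_star n p <= l ->
  exists R0, 0 < R0 /\ forall Rad, 0 < Rad < R0 ->
    ~ exists u, radial_solution n p K Rad u.
Proof.
intros Hp HC1 HA HB Hl HK Hh Hle.
destruct (weight_near_0 K h A B l HC1 HA HB Hl HK Hh) as [rho [Hrho Hnear]].
assert (Hq := crit_gt _ _ Hp).
(* The target is half of [(p - 1)/p], so that the inequality of [dirichlet_radius_ge] fails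
   strictly. *)
destruct (Rpower_small l
  (2 * (B * l) / (crit (INR n) p * (A / 2) * ell (INR n) p)) ((p - 1) / p / 2) Hl)
  as [delta [Hdelta Hsmall]]; [pos|].
exists (Rmin delta rho); split; [now apply Rmin_glb_lt|].
intros Rad HRad [u [d [T [Hd [HT [Hreg [Hpos Hzero]]]]]]].
assert (H1 := Rmin_l delta rho); assert (H2 := Rmin_r delta rho).
assert (Hprof : profile (INR n) p K u (radial_flux n p u) d Rad).
{ apply (profile_of_regular n p d T); auto; try lra.
  - intros r Hr; assert (Hn := Hnear r ltac:(lra)); lra.
  - intros r Hr; apply Hpos; lra. }
destruct Hreg as [_ [_ Hode]].
(* The equation holds at [Rad] itself because [T > Rad]; hence [u] and the flux are continuous
   there. *)
destruct (radial_ode_system n p K u Rad Hp ltac:(lra) (Hode Rad ltac:(lra))) as [Hu Hw].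
assert (Hge := dirichlet_radius_ge (INR n) p l (2 * (B * l)) (A / 2) (2 * A) d Rad
  K (Derive K) u (radial_flux n p u) Hp Hle ltac:(lra) ltac:(pos) ltac:(lra) Hprof
  ltac:(intros r Hr; apply Hnear; lra) ltac:(intros r Hr; apply Hnear; lra)
  ltac:(intros r Hr; apply Hnear; lra)
  (is_derive_continuous _ _ _ Hu) (is_derive_continuous _ _ _ Hw) Hzero).
specialize (Hsmall Rad ltac:(lra)).
assert (0 < (p - 1) / p) by pos.
lra.
Qed.

Lemma no_positive_regular_solution_large (n : nat) (p : R) (K h : R -> R) (A B l Rad : R) :
  1 < p < INR n -> C1_halfline K -> 0 < A -> 0 < B -> 0 < l ->
  (forall r, 0 <= r -> K r = A + B * rpow r l + h r) ->
  filterlim (fun r => (Rabs (h r) + r * Rabs (Derive h r)) / rpow r l)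
    (at_right 0) (locally 0) ->
  l < ell_star n p -> 0 < Rad ->
  exists D, 0 < D /\ forall d u, D <= d -> regular_solution n p K d Rad u ->
    ~ (forall r, 0 < r < Rad -> 0 < u r).
Proof.
intros Hp HC1 HA HB Hl HK Hh Hlt HRad.
destruct (weight_near_0 K h A B l HC1 HA HB Hl HK Hh) as [rho0 [Hrho0 Hnear]].
(* [K'] is controlled only near [0], so [u] is considered on this smaller ball. *)
set (rho := Rmin rho0 Rad).
assert (H1 : rho <= rho0) by apply Rmin_l; assert (H2 : rho <= Rad) by apply Rmin_r.
assert (Hrho : 0 < rho) by now apply Rmin_glb_lt.
assert (HBl : 0 < B * l / 2) by pos.
destruct (no_large_profile (INR n) p l (B * l / 2) (A / 2) (2 * A) rho Hp
  (conj Hl Hlt) HBl ltac:(lra) Hrho) as [D [HD Hno]].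
exists D; split; [exact HD|]; intros d u Hd Hreg Hpos.
apply (Hno d K (Derive K) u (radial_flux n p u) Hd);
  try (intros r Hr; apply Hnear; lra).
apply (profile_of_regular n p d Rad); auto.
- intros r Hr; assert (Hn := Hnear r ltac:(lra)); lra.
- intros r Hr; apply Hpos; lra.
Qed.

(** * Existence and dependence on the initial value *)

Lemma pow_half_small (C eps : R) : 0 < eps ->
  exists k0, forall k, (k0 <= k)%nat -> C * (1 / 2) ^ k <= eps.
Proof.
intros He.
set (D := Rabs C + 1).
assert (HD : 0 < D) by (assert (H := Rabs_pos C); unfold D; lra).
destruct (pow_lt_1_zero (1 / 2) ltac:(rewrite Rabs_pos_eq; lra) (eps / D) ltac:(pos))
  as [k0 Hk0].
exists k0; intros k Hk.
specialize (Hk0 k Hk).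
assert (Hp : 0 < (1 / 2) ^ k) by (apply pow_lt; lra).
rewrite Rabs_pos_eq in Hk0 by lra.
apply Rle_trans with (D * (1 / 2) ^ k).
- apply Rmult_le_compat_r; [lra|]; assert (H := Rle_abs C); unfold D; lra.
- apply Rle_trans with (D * (eps / D)); [apply Rmult_le_compat_l; lra|].
  right; field; lra.
Qed.

Lemma le_of_le_pow_half (x y C : R) :
  (forall k, x <= y + C * (1 / 2) ^ k) -> x <= y.
Proof.
intros H; apply le_epsilon; intros eps He.
destruct (pow_half_small C eps He) as [k0 Hk0].
specialize (H k0); specialize (Hk0 k0 (le_n _)); lra.
Qed.

Lemma continuous_R_elim (f : R -> R) (x : R) :
  continuous f x -> forall eps, 0 < eps -> exists delta, 0 < delta /\
    forall s, Rabs (s - x) < delta -> Rabs (f s - f x) < eps.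
Proof.
intros H eps He.
assert (Hn : locally x (fun s => Rabs (f s - f x) < eps)).
{ apply (H (fun z => Rabs (z - f x) < eps)).
  exists (mkposreal eps He); intros z Hz; exact Hz. }
destruct Hn as [delta Hd]; exists delta; split; [apply cond_pos|].
intros s Hs; apply Hd, Hs.
Qed.

Lemma continuous_R_intro (f : R -> R) (x : R) :
  (forall eps, 0 < eps -> exists delta, 0 < delta /\
    forall s, Rabs (s - x) < delta -> Rabs (f s - f x) < eps) -> continuous f x.
Proof.
intros H P [eps He].
destruct (H eps (cond_pos eps)) as [delta [Hd Hs]].
exists (mkposreal delta Hd); intros s Hsx; apply He, Hs, Hsx.
Qed.

(* Picard iteration for [u = d - Op u] in the norm [sup |v| / E]. *)
Lemma picard (Op : (R -> R) -> R -> R) (E : R -> R) (Emax : R) :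
  (forall r, 1 <= E r <= Emax) ->
  (forall v, (forall r, continuous v r) -> forall r, continuous (Op v) r) ->
  (forall r, Op (fun _ => 0) r = 0) ->
  (forall v v' delta, (forall r, continuous v r) -> (forall r, continuous v' r) ->
     (forall r, Rabs (v r - v' r) <= delta * E r) ->
     forall r, Rabs (Op v r - Op v' r) <= delta / 2 * E r) ->
  exists U : R -> R -> R,
    (forall d r, continuous (U d) r) /\
    (forall d r, U d r = d - Op (U d) r) /\
    (forall d r, Rabs (U d r) <= 2 * Rabs d * E r) /\
    (forall d d' r, Rabs (U d r - U d' r) <= 2 * Rabs (d - d') * E r).
Proof.
intros HE Hcont H0 Hlip.
set (it := fix it (d : R) (k : nat) : R -> R :=
  match k with O => fun _ => d | S j => fun r => d - Op (it d j) r end).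
assert (Hitc : forall d k r, continuous (it d k) r).
{ intros d k; induction k as [|k IH]; intros r; simpl; [apply continuous_const|].
  apply (continuous_minus (fun _ => d) (Op (it d k))); [apply continuous_const|].
  now apply Hcont. }
(* The constant 2 reproduces itself under iteration, as [1 + 2/2 = 2] and [E >= 1]; the same holds
   for [Hdd]. *)
assert (Hbd : forall d k r, Rabs (it d k r) <= 2 * Rabs d * E r).
{ intros d k; induction k as [|k IH]; intros r; simpl;
    assert (HEr := HE r); assert (Hd := Rabs_pos d); [nra|].
  assert (H1 : Rabs (Op (it d k) r - Op (fun _ => 0) r) <= 2 * Rabs d / 2 * E r).
  { apply Hlip; auto; [intros; apply continuous_const|].
    intros s; rewrite Rminus_0_r; apply IH. }
  rewrite H0, Rminus_0_r in H1.
  assert (H2 := Rabs_triang d (- Op (it d k) r)); rewrite Rabs_Ropp in H2.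
  unfold Rminus; nra. }
assert (Hdd : forall d d' k r, Rabs (it d k r - it d' k r) <= 2 * Rabs (d - d') * E r).
{ intros d d' k; induction k as [|k IH]; intros r; simpl;
    assert (HEr := HE r); assert (Hd := Rabs_pos (d - d')); [nra|].
  assert (H1 : Rabs (Op (it d k) r - Op (it d' k) r) <= 2 * Rabs (d - d') / 2 * E r)
    by (apply Hlip; auto).
  replace (d - Op (it d k) r - (d' - Op (it d' k) r)) with
    ((d - d') + - (Op (it d k) r - Op (it d' k) r)) by ring.
  assert (H2 := Rabs_triang (d - d') (- (Op (it d k) r - Op (it d' k) r))).
  rewrite Rabs_Ropp in H2; nra. }
assert (Hstep : forall d k r,
   Rabs (it d (S k) r - it d k r) <= Rabs d * (1 / 2) ^ k * E r).
{ intros d k; induction k as [|k IH]; intros r.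
  - simpl; assert (H1 : Rabs (Op (fun _ => d) r - Op (fun _ => 0) r) <= Rabs d / 2 * E r).
    { apply Hlip; try (intros; apply continuous_const).
      intros s; rewrite Rminus_0_r; assert (HEs := HE s); assert (Hd := Rabs_pos d); nra. }
    rewrite H0, Rminus_0_r in H1.
    replace (d - Op (fun _ => d) r - d) with (- Op (fun _ => d) r) by ring.
    rewrite Rabs_Ropp; assert (HEr := HE r); assert (Hd := Rabs_pos d); nra.
  - replace (it d (S (S k)) r - it d (S k) r) with
      (- (Op (it d (S k)) r - Op (it d k) r)) by (simpl; ring).
    rewrite Rabs_Ropp.
    replace (Rabs d * (1 / 2) ^ S k * E r) with (Rabs d * (1 / 2) ^ k / 2 * E r)
      by (simpl; field).
    apply Hlip; auto. }
(* The exact geometric sum, with its factor [1 - (1/2)^j], is kept so that the induction on [j]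
   closes. *)
assert (Hcauchy : forall d k j r,
   Rabs (it d (k + j)%nat r - it d k r) <= Rabs d * 2 * Emax * (1 / 2) ^ k * (1 - (1 / 2) ^ j)).
{ intros d k j r; induction j as [|j IH].
  - rewrite Nat.add_0_r; unfold Rminus at 1; rewrite Rplus_opp_r, Rabs_R0; simpl; lra.
  - rewrite Nat.add_succ_r.
    assert (H1 := Hstep d (k + j)%nat r).
    replace (it d (S (k + j)) r - it d k r) with
      ((it d (S (k + j)) r - it d (k + j)%nat r) + (it d (k + j)%nat r - it d k r)) by ring.
    assert (H2 := Rabs_triang (it d (S (k + j)) r - it d (k + j)%nat r)
                              (it d (k + j)%nat r - it d k r)).
    assert (H3 : Rabs d * (1 / 2) ^ (k + j) * E r <= Rabs d * (1 / 2) ^ (k + j) * Emax).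
    { apply Rmult_le_compat_l; [|apply HE].
      apply Rmult_le_pos; [apply Rabs_pos | apply pow_le; lra]. }
    replace (Rabs d * 2 * Emax * (1 / 2) ^ k * (1 - (1 / 2) ^ S j)) with
      (Rabs d * (1 / 2) ^ (k + j) * Emax
       + Rabs d * 2 * Emax * (1 / 2) ^ k * (1 - (1 / 2) ^ j))
      by (rewrite pow_add; simpl; field).
    lra. }
assert (HEmax : 1 <= Emax) by (assert (H := HE 0); lra).
assert (Hcauchy' : forall d k j r, (k <= j)%nat ->
   Rabs (it d j r - it d k r) <= Rabs d * 2 * Emax * (1 / 2) ^ k).
{ intros d k j r Hkj; replace j with (k + (j - k))%nat by lia.
  eapply Rle_trans; [apply Hcauchy|].
  rewrite <- (Rmult_1_r (Rabs d * 2 * Emax * (1 / 2) ^ k)) at 2.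
  assert (0 <= (1 / 2) ^ (j - k)) by (apply pow_le; lra).
  assert (0 <= (1 / 2) ^ k) by (apply pow_le; lra).
  assert (Hd := Rabs_pos d).
  apply Rmult_le_compat_l; [|lra].
  repeat apply Rmult_le_pos; lra. }
assert (Hex : forall d r, exists y, forall k,
   Rabs (y - it d k r) <= Rabs d * 2 * Emax * (1 / 2) ^ k).
{ intros d r.
  assert (Hc : ex_finite_lim_seq (fun k => it d k r)).
  { apply ex_lim_seq_cauchy_corr; intros eps.
    destruct (pow_half_small (Rabs d * 2 * Emax) (eps / 4)) as [k0 Hk0].
    { assert (He := cond_pos eps); lra. }
    exists k0; intros m m' Hm Hm'.
    specialize (Hk0 k0 (le_n _)).
    assert (H1 := Hcauchy' d k0 m r Hm); assert (H2 := Hcauchy' d k0 m' r Hm').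
    assert (He := cond_pos eps).
    apply Rabs_le_between in H1; apply Rabs_le_between in H2.
    apply Rabs_lt_between; lra. }
  destruct Hc as [y Hy]; exists y; intros k.
  change (Rbar_le (Finite (Rabs (y - it d k r)))
    (Finite (Rabs d * 2 * Emax * (1 / 2) ^ k))).
  apply (is_lim_seq_le_loc (fun j => Rabs (it d j r - it d k r))
    (fun _ => Rabs d * 2 * Emax * (1 / 2) ^ k)).
  - exists k; intros j Hj; apply Hcauchy', Hj.
  - apply (is_lim_seq_abs _ (Finite (y - it d k r))).
    apply is_lim_seq_minus'; [exact Hy | apply is_lim_seq_const].
  - apply is_lim_seq_const. }
(* [Lim_seq] is total, so the limits form a function of [d] and [r] without any choice. *)
set (U := fun d r => real (Lim_seq (fun k => it d k r))).
assert (HU : forall d k r, Rabs (U d r - it d k r) <= Rabs d * 2 * Emax * (1 / 2) ^ k).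
{ intros d k r; destruct (Hex d r) as [y Hy].
  replace (U d r) with y; [apply Hy|].
  symmetry; unfold U; rewrite (is_lim_seq_unique _ (Finite y)); [reflexivity|].
  apply is_lim_seq_Reals; intros eps He.
  destruct (pow_half_small (Rabs d * 2 * Emax) (eps / 2)) as [k0 Hk0]; [lra|].
  exists k0; intros k' Hk'; unfold Rdist; rewrite Rabs_minus_sym.
  specialize (Hy k'); specialize (Hk0 k' Hk'); lra. }
clear Hex.
assert (HUc : forall d r, continuous (U d) r).
{ intros d r; apply continuous_R_intro; intros eps He.
  destruct (pow_half_small (Rabs d * 2 * Emax) (eps / 4)) as [k0 Hk0]; [lra|].
  specialize (Hk0 k0 (le_n _)).
  destruct (continuous_R_elim (it d k0) r (Hitc d k0 r) (eps / 4)) as [delta [Hd Hs]]; [lra|].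
  exists delta; split; [exact Hd|]; intros s Hsr.
  specialize (Hs s Hsr).
  assert (H1 := HU d k0 s); assert (H2 := HU d k0 r).
  apply Rabs_le_between in H1; apply Rabs_le_between in H2.
  apply Rabs_lt_between in Hs; apply Rabs_lt_between; lra. }
exists U; split; [exact HUc|]; split; [|split].
- intros d r.
  assert (Hz : Rabs (U d r - (d - Op (U d) r)) <= 0).
  { apply (le_of_le_pow_half _ _ (2 * (Rabs d * 2 * Emax) * Emax)); intros k.
    assert (H1 := HU d (S k) r).
    assert (H2 : Rabs (Op (U d) r - Op (it d k) r) <=
        Rabs d * 2 * Emax * (1 / 2) ^ k / 2 * E r).
    { apply Hlip; auto; intros s; eapply Rle_trans; [apply HU|].
      rewrite <- (Rmult_1_r (Rabs d * 2 * Emax * (1 / 2) ^ k)) at 1.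
      apply Rmult_le_compat_l; [|apply HE].
      assert (Hd := Rabs_pos d).
      assert (0 <= (1 / 2) ^ k) by (apply pow_le; lra).
      repeat apply Rmult_le_pos; lra. }
    replace (U d r - (d - Op (U d) r)) with
      ((U d r - it d (S k) r) + (Op (U d) r - Op (it d k) r)) by (simpl; ring).
    assert (H3 := Rabs_triang (U d r - it d (S k) r) (Op (U d) r - Op (it d k) r)).
    simpl pow in H1.
    assert (Hd := Rabs_pos d).
    assert (Hpk : 0 <= (1 / 2) ^ k) by (apply pow_le; lra).
    assert (HEr := HE r).
    assert (H4 : 0 <= Rabs d * 2 * Emax * (1 / 2) ^ k)
      by (repeat apply Rmult_le_pos; lra).
    set (a := Rabs d * 2 * Emax * (1 / 2) ^ k) in *.
    replace (2 * (Rabs d * 2 * Emax) * Emax * (1 / 2) ^ k) with (2 * a * Emax)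
      by (unfold a; ring).
    replace (Rabs d * 2 * Emax * (1 / 2 * (1 / 2) ^ k)) with (a / 2) in H1
      by (unfold a; field).
    nra. }
  assert (Hz' := Rabs_pos (U d r - (d - Op (U d) r))).
  destruct (Req_dec (U d r - (d - Op (U d) r)) 0) as [He | Hne]; [lra|].
  apply Rabs_pos_lt in Hne; lra.
- intros d r; apply (le_of_le_pow_half _ _ (Rabs d * 2 * Emax)); intros k.
  assert (H1 := HU d k r); assert (H2 := Hbd d k r).
  apply Rabs_le_between in H1; apply Rabs_le_between in H2.
  apply Rabs_le_between; lra.
- intros d d' r.
  apply (le_of_le_pow_half _ _ (Rabs d * 2 * Emax + Rabs d' * 2 * Emax)); intros k.
  assert (H1 := HU d k r); assert (H2 := HU d' k r); assert (H3 := Hdd d d' k r).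
  apply Rabs_le_between in H1; apply Rabs_le_between in H2; apply Rabs_le_between in H3.
  apply Rabs_le_between; lra.
Qed.

(** * Lipschitz bounds for signed powers, and truncation *)

Lemma signed_pow_lipschitz_pos (a M x y : R) : 2 <= a -> 0 <= x -> x <= y -> y <= M ->
  0 <= signed_pow a y - signed_pow a x <= (a - 1) * Rpower M (a - 2) * (y - x).
Proof.
intros Ha Hx Hxy HyM.
destruct (Req_dec x y) as [<- | Hne]; [lra|].
set (L := (a - 1) * Rpower M (a - 2)).
assert (HP := Rpower_gt_0 M (a - 2)).
(* [Rpower 0 _] is [1], so the power form of [signed_pow] and its derivative are available only for
   positive arguments. *)
destruct (Req_dec x 0) as [-> | Hx0].
- rewrite signed_pow_0; unfold signed_pow; rewrite Rabs_pos_eq by lra.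
  assert (H := Rpower_gt_0 y (a - 2)).
  assert (H1 : Rpower y (a - 2) <= Rpower M (a - 2)) by (apply Rle_Rpower_l; lra).
  assert (H2 : 0 <= y * (Rpower M (a - 2) - Rpower y (a - 2))) by (apply Rmult_le_pos; lra).
  assert (H3 : 0 <= (a - 2) * (y * Rpower M (a - 2)))
    by (repeat apply Rmult_le_pos; lra).
  unfold L; split; nra.
- rewrite 2!signed_pow_pos by lra; split.
  + assert (Rpower x (a - 1) <= Rpower y (a - 1)) by (apply Rle_Rpower_l; lra); lra.
  + assert (L * x - Rpower x (a - 1) <= L * y - Rpower y (a - 1)); [|lra].
    assert (Hd : forall t, 0 < t -> is_derive (fun t => L * t - Rpower t (a - 1)) t
       (L * 1 - (a - 1) * Rpower t (a - 1 - 1))).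
    { intros s Hs; apply is_derive_Rminus; [|apply is_derive_Rpower; lra].
      apply is_derive_Rscal; exact (is_derive_id s). }
    apply (le_of_derive_ge_0 (fun t => L * t - Rpower t (a - 1))
      (fun t => L * 1 - (a - 1) * Rpower t (a - 1 - 1))); [lra| | |].
    * intros t Ht; apply Hd; lra.
    * intros t Ht; eapply is_derive_continuous, Hd; lra.
    * intros t Ht; replace (a - 1 - 1) with (a - 2) by ring.
      assert (H1 : Rpower t (a - 2) <= Rpower M (a - 2)) by (apply Rle_Rpower_l; lra).
      unfold L; nra.
Qed.

Lemma signed_pow_lipschitz (a M : R) : 2 <= a -> exists L, 0 < L /\
  forall x y, Rabs x <= M -> Rabs y <= M ->
    Rabs (signed_pow a x - signed_pow a y) <= L * Rabs (x - y).
Proof.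
intros Ha; exists ((a - 1) * Rpower M (a - 2)); split; [pos|].
set (L := (a - 1) * Rpower M (a - 2)).
assert (Hle : forall x y, - M <= x -> x <= y -> y <= M ->
  0 <= signed_pow a y - signed_pow a x <= L * (y - x)).
{ intros x y Hx Hxy Hy.
  destruct (Rle_dec 0 x) as [Hx0 | Hx0]; [now apply signed_pow_lipschitz_pos|].
  destruct (Rle_dec 0 y) as [Hy0 | Hy0].
  (* For opposite signs, the estimates on both sides of [0] add up, by oddness. *)
  - assert (H1 := signed_pow_lipschitz_pos a M 0 y Ha (Rle_refl 0) Hy0 Hy).
    assert (H2 := signed_pow_lipschitz_pos a M 0 (- x) Ha (Rle_refl 0) ltac:(lra) ltac:(lra)).
    rewrite signed_pow_opp in H2; rewrite signed_pow_0 in *; fold L in H1, H2; lra.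
  - assert (H2 := signed_pow_lipschitz_pos a M (- y) (- x) Ha ltac:(lra) ltac:(lra) ltac:(lra)).
    rewrite 2!signed_pow_opp in H2; fold L in H2; lra. }
intros x y Hx Hy; apply Rabs_le_between in Hx; apply Rabs_le_between in Hy.
destruct (Rle_dec x y) as [Hxy | Hxy].
- rewrite Rabs_minus_sym, (Rabs_minus_sym x y).
  assert (H := Hle x y ltac:(lra) Hxy ltac:(lra)); rewrite 2!Rabs_pos_eq; lra.
- assert (H := Hle y x ltac:(lra) ltac:(lra) ltac:(lra)); rewrite 2!Rabs_pos_eq; lra.
Qed.

Definition clamp (a b x : R) : R := Rmax a (Rmin x b).

Lemma clamp_bounds (a b x : R) : a <= b -> a <= clamp a b x <= b.
Proof.
intros Hab; unfold clamp; split; [apply Rmax_l|].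
apply Rmax_lub; [exact Hab | apply Rmin_r].
Qed.

Lemma clamp_id (a b x : R) : a <= x <= b -> clamp a b x = x.
Proof. intros Hx; unfold clamp; rewrite Rmin_left, Rmax_right; lra. Qed.

Lemma clamp_lipschitz (a b x y : R) : Rabs (clamp a b x - clamp a b y) <= Rabs (x - y).
Proof.
apply Rle_trans with (Rabs (Rmin x b - Rmin y b)); unfold clamp;
  [generalize (Rmin x b) (Rmin y b); intros x' y'; unfold Rmax | unfold Rmin];
  repeat (match goal with |- context [Rle_dec ?u ?v] => destruct (Rle_dec u v) end);
  unfold Rabs; repeat (match goal with |- context [Rcase_abs ?u] => destruct (Rcase_abs u) end);
  lra.
Qed.

Lemma lipschitz_continuous (f : R -> R) (L : R) :
  (forall x y, Rabs (f x - f y) <= L * Rabs (x - y)) -> forall x, continuous f x.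
Proof.
intros H x; apply continuous_R_intro; intros eps He.
set (D := Rabs L + 1).
assert (HD : 0 < D) by (assert (H0 := Rabs_pos L); unfold D; lra).
exists (eps / D); split; [pos|]; intros s Hs.
apply Rle_lt_trans with (1 := H s x).
apply Rle_lt_trans with (D * Rabs (s - x)).
- apply Rmult_le_compat_r; [apply Rabs_pos|]; assert (H0 := Rle_abs L); unfold D; lra.
- apply (Rmult_lt_compat_l D) in Hs; [|exact HD].
  replace (D * (eps / D)) with eps in Hs by (field; lra); exact Hs.
Qed.

Lemma continuous_clamp (a b x : R) : continuous (clamp a b) x.
Proof.
apply (lipschitz_continuous _ 1); intros y z; rewrite Rmult_1_l; apply clamp_lipschitz.
Qed.

(** * The integral equation for the truncated problem *)

Lemma is_derive_RInt_continuous (F : R -> R) (r : R) :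
  (forall t, continuous F t) -> is_derive (fun s => RInt F 0 s) r (F r).
Proof.
intros HF; apply (is_derive_RInt F (fun s => RInt F 0 s) 0 r); [|apply HF].
exists (mkposreal 1 Rlt_0_1); intros s _.
apply (RInt_correct F), (ex_RInt_continuous F); intros z _; apply HF.
Qed.

(** In the norm weighted by [exp (L t)], integration gains a factor [1/L]; this gives a contraction
    on an interval of any length. *)
Lemma RInt_exp_bound (F : R -> R) (k L s : R) :
  0 < L -> 0 <= k -> 0 <= s -> (forall t, continuous F t) ->
  (forall t, 0 < t < s -> Rabs (F t) <= k * exp (L * t)) ->
  Rabs (RInt F 0 s) <= k / L * exp (L * s).
Proof.
intros HL Hk Hs HF Hb.
assert (Hde : forall t, is_derive (fun t => k / L * exp (L * t)) t (k * exp (L * t))).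
{ intros t; auto_derive; [exact I | field; lra]. }
assert (Hce : forall t, continuous (fun t => k * exp (L * t)) t).
{ intros t; apply (ex_derive_continuous (K := R_AbsRing) (V := R_NormedModule)).
  auto_derive; exact I. }
assert (HI := is_RInt_derive (fun t => k / L * exp (L * t)) (fun t => k * exp (L * t)) 0 s
  (fun t _ => Hde t) (fun t _ => Hce t)).
assert (HexF : ex_RInt F 0 s) by (apply (ex_RInt_continuous F); intros; apply HF).
apply Rle_trans with (RInt (fun t => Rabs (F t)) 0 s); [now apply abs_RInt_le|].
apply Rle_trans with (RInt (fun t => k * exp (L * t)) 0 s).
- apply RInt_le; [exact Hs | | exists (minus (k / L * exp (L * s)) (k / L * exp (L * 0))); exact HI | exact Hb].
  apply (ex_RInt_continuous (fun t => Rabs (F t))); intros z _.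
  apply (continuous_comp F Rabs); [apply HF | apply continuous_Rabs].
- rewrite (is_RInt_unique _ _ _ _ HI); unfold minus, plus, opp; simpl.
  assert (0 <= k / L * exp (L * 0)); [|lra].
  apply Rmult_le_pos; [apply Rdiv_le_0_compat; lra | left; apply exp_pos].
Qed.

(** For [H = K u^(q-1)] this is [w / s^(n-1) = |u'|^(p-1)]. At [s = 0] it is [0], because the
    integral over a point vanishes. *)
Definition radial_mean (n : nat) (H : R -> R) (s : R) : R :=
  RInt (fun t => t ^ (n - 1) * H t) 0 s / s ^ (n - 1).

Lemma continuous_pow_mult (k : nat) (H : R -> R) :
  (forall t, continuous H t) -> forall t, continuous (fun t => t ^ k * H t) t.
Proof.
intros HH t; apply (continuous_mult (K := R_AbsRing)); [|apply HH].
apply (ex_derive_continuous (K := R_AbsRing) (V := R_NormedModule)).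
auto_derive; exact I.
Qed.

Lemma radial_mean_bound (n : nat) (H : R -> R) (M s : R) :
  (2 <= n)%nat -> (forall t, continuous H t) -> (forall t, Rabs (H t) <= M) ->
  Rabs (radial_mean n H s) <= M * Rabs s.
Proof.
intros Hn HH HM.
assert (HM0 : 0 <= M) by (eapply Rle_trans; [apply Rabs_pos | apply (HM 0)]).
unfold radial_mean.
destruct (Req_dec s 0) as [-> | Hs].
{ rewrite RInt_point; unfold zero; simpl; unfold Rdiv; rewrite Rmult_0_l, Rabs_R0; lra. }
assert (Hsn : s ^ (n - 1) <> 0) by now apply pow_nonzero.
assert (Hb : Rabs (RInt (fun t => t ^ (n - 1) * H t) 0 s) <=
   Rabs (s - 0) * (Rabs s ^ (n - 1) * M)).
{ apply (norm_RInt_le_const_abs (V := R_NormedModule) (fun t => t ^ (n - 1) * H t) 0 s).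
  - intros t Ht; change (Rabs (t ^ (n - 1) * H t) <= Rabs s ^ (n - 1) * M).
    rewrite Rabs_mult, <- RPow_abs.
    apply Rmult_le_compat; auto using Rabs_pos, pow_le.
    apply pow_incr; split; [apply Rabs_pos|].
    unfold Rmin, Rmax in Ht; destruct (Rle_dec 0 s) in Ht;
      unfold Rabs; destruct (Rcase_abs t); destruct (Rcase_abs s); lra.
  - apply (RInt_correct (fun t => t ^ (n - 1) * H t)).
    apply (ex_RInt_continuous (fun t => t ^ (n - 1) * H t)).
    intros z _; now apply continuous_pow_mult. }
rewrite Rminus_0_r in Hb.
unfold Rdiv; rewrite Rabs_mult, Rabs_inv, <- RPow_abs.
assert (Hp : 0 < Rabs s ^ (n - 1)) by (apply pow_lt, Rabs_pos_lt, Hs).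
apply Rmult_le_reg_r with (Rabs s ^ (n - 1)); [exact Hp|].
rewrite Rmult_assoc, Rinv_l, Rmult_1_r by lra; lra.
Qed.

Lemma continuous_radial_mean (n : nat) (H : R -> R) (M : R) :
  (2 <= n)%nat -> (forall t, continuous H t) -> (forall t, Rabs (H t) <= M) ->
  forall s, continuous (radial_mean n H) s.
Proof.
intros Hn HH HM s.
destruct (Req_dec s 0) as [-> | Hs].
- apply continuous_R_intro; intros eps He.
  assert (HM0 : 0 <= M) by (eapply Rle_trans; [apply Rabs_pos | apply (HM 0)]).
  exists (eps / (M + 1)); split; [pos|]; intros s Hs; rewrite Rminus_0_r in Hs.
  assert (H1 := radial_mean_bound n H M s Hn HH HM).
  assert (H0 := radial_mean_bound n H M 0 Hn HH HM).
  rewrite Rabs_R0, Rmult_0_r in H0.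
  assert (H2 : (M + 1) * Rabs s < eps).
  { apply (Rmult_lt_compat_l (M + 1)) in Hs; [|lra].
    replace ((M + 1) * (eps / (M + 1))) with eps in Hs by (field; lra); exact Hs. }
  assert (H3 := Rabs_pos s); apply Rabs_le_between in H0; apply Rabs_le_between in H1.
  apply Rabs_lt_between; lra.
- unfold radial_mean, Rdiv; apply (continuous_mult (K := R_AbsRing)).
  + eapply is_derive_continuous, (is_derive_RInt_continuous (fun t => t ^ (n - 1) * H t)).
    now apply continuous_pow_mult.
  + apply (ex_derive_continuous (K := R_AbsRing) (V := R_NormedModule)).
    auto_derive; now apply pow_nonzero.
Qed.

(** As [t^(n-1) <= s^(n-1)], the weight is absorbed by the denominator, and the gain [1/L] is that
    of a plain integral. *)
Lemma radial_mean_exp_bound (n : nat) (H : R -> R) (k L s : R) :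
  0 < L -> 0 <= k -> 0 < s -> (forall t, continuous H t) ->
  (forall t, 0 < t < s -> Rabs (H t) <= k * exp (L * t)) ->
  Rabs (radial_mean n H s) <= k / L * exp (L * s).
Proof.
intros HL Hk Hs HH Hb.
assert (Hp : 0 < s ^ (n - 1)) by now apply pow_lt.
assert (H1 : Rabs (RInt (fun t => t ^ (n - 1) * H t) 0 s) <=
   s ^ (n - 1) * k / L * exp (L * s)).
{ apply RInt_exp_bound; [exact HL | apply Rmult_le_pos; lra | lra | now apply continuous_pow_mult |].
  intros t Ht; rewrite Rabs_mult, Rmult_assoc.
  apply Rmult_le_compat; auto using Rabs_pos.
  rewrite Rabs_pos_eq by (apply pow_le; lra); apply pow_incr; lra. }
unfold radial_mean, Rdiv; rewrite Rabs_mult, Rabs_inv, (Rabs_pos_eq (s ^ (n - 1))) by lra.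
apply Rmult_le_reg_r with (s ^ (n - 1)); [exact Hp|].
rewrite Rmult_assoc, Rinv_l, Rmult_1_r by lra; unfold Rdiv in H1; lra.
Qed.

Lemma radial_mean_minus (n : nat) (H H' : R -> R) (s : R) :
  (forall t, continuous H t) -> (forall t, continuous H' t) ->
  radial_mean n H s - radial_mean n H' s = radial_mean n (fun t => H t - H' t) s.
Proof.
intros HH HH'; unfold radial_mean.
rewrite (RInt_ext (fun t => t ^ (n - 1) * (H t - H' t))
  (fun t => minus (t ^ (n - 1) * H t) (t ^ (n - 1) * H' t))).
- rewrite (RInt_minus (fun t => t ^ (n - 1) * H t) (fun t => t ^ (n - 1) * H' t)).
  + unfold minus, plus, opp; simpl; unfold Rdiv; ring.
  + apply (ex_RInt_continuous (fun t => t ^ (n - 1) * H t)); intros;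
      now apply continuous_pow_mult.
  + apply (ex_RInt_continuous (fun t => t ^ (n - 1) * H' t)); intros;
      now apply continuous_pow_mult.
- intros t _; unfold minus, plus, opp; simpl; ring.
Qed.

(** [f] stands for the truncated nonlinearity and [g] for the inverse of the flux law. Freezing the
    integral outside [[0, Tm]] with [clamp] produces functions continuous on the whole line, as
    [picard] requires. *)
Lemma radial_ivp (n : nat) (Tm Kmax Lf Mf Lg : R) (K f g : R -> R) :
  (2 <= n)%nat -> 0 < Tm -> 0 < Lf -> 0 < Lg ->
  (forall r, continuous K r) -> (forall r, Rabs (K r) <= Kmax) ->
  (forall x y, Rabs (f x - f y) <= Lf * Rabs (x - y)) -> f 0 = 0 ->
  (forall x, Rabs (f x) <= Mf) ->
  (forall x y, Rabs (g x - g y) <= Lg * Rabs (x - y)) -> g 0 = 0 ->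
  exists (U : R -> R -> R) (C : R), 0 < C /\
    (forall d r, continuous (U d) r) /\
    (forall d r, U d r =
       d - RInt (fun s => g (radial_mean n (fun t => K t * f (U d t)) s)) 0 (clamp 0 Tm r)) /\
    (forall d r, Rabs (U d r) <= C * Rabs d) /\
    (forall d d' r, Rabs (U d r - U d' r) <= C * Rabs (d - d')).
Proof.
intros Hn HTm HLf HLg HKc HKb Hf Hf0 HMf Hg Hg0.
assert (HKmax : 0 <= Kmax) by (eapply Rle_trans; [apply Rabs_pos | apply (HKb 0)]).
assert (HMf0 : 0 <= Mf) by (eapply Rle_trans; [apply Rabs_pos | apply (HMf 0)]).
assert (Hfc := lipschitz_continuous f Lf Hf).
assert (Hgc := lipschitz_continuous g Lg Hg).
(* The two integrations together contribute [Lg Kmax Lf / L^2], which is at most [1/2]. *)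
set (L := 2 * (Lg * (Kmax * Lf)) + 1).
assert (HLL : 0 <= Lg * (Kmax * Lf)) by (repeat apply Rmult_le_pos; lra).
assert (HL : 1 <= L) by (unfold L; lra).
set (E := fun r => exp (L * clamp 0 Tm r)).
assert (Hcl : forall r, 0 <= clamp 0 Tm r <= Tm) by (intros r; apply clamp_bounds; lra).
assert (HE : forall r, 1 <= E r <= exp (L * Tm)).
{ intros r; unfold E; specialize (Hcl r); split.
  - rewrite <- exp_0 at 1.
    destruct (Req_dec (L * clamp 0 Tm r) 0) as [-> | Hne]; [lra|].
    left; apply exp_increasing.
    assert (0 <= L * clamp 0 Tm r) by (apply Rmult_le_pos; lra); lra.
  - destruct (Req_dec (clamp 0 Tm r) Tm) as [-> | Hne]; [lra|].
    left; apply exp_increasing, Rmult_lt_compat_l; lra. }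
set (H := fun (v : R -> R) t => K t * f (v t)).
assert (HHc : forall v, (forall r, continuous v r) -> forall r, continuous (H v) r).
{ intros v Hv r; apply (continuous_mult (K := R_AbsRing)); [apply HKc|].
  apply (continuous_comp v f); [apply Hv | apply Hfc]. }
assert (HHb : forall v t, Rabs (H v t) <= Kmax * Mf).
{ intros v t; unfold H; rewrite Rabs_mult.
  apply Rmult_le_compat; auto using Rabs_pos. }
assert (HGc : forall v, (forall r, continuous v r) ->
   forall s, continuous (fun s => g (radial_mean n (H v) s)) s).
{ intros v Hv s; apply (continuous_comp (radial_mean n (H v)) g); [|apply Hgc].
  apply (continuous_radial_mean n (H v) (Kmax * Mf)); auto. }
destruct (picard (fun v r => RInt (fun s => g (radial_mean n (H v) s)) 0 (clamp 0 Tm r))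
  E (exp (L * Tm)) HE) as [U [HU1 [HU2 [HU3 HU4]]]].
- intros v Hv r.
  apply (continuous_comp (clamp 0 Tm) (fun x => RInt (fun s => g (radial_mean n (H v) s)) 0 x)).
  + apply continuous_clamp.
  + eapply is_derive_continuous, (is_derive_RInt_continuous (fun s => g (radial_mean n (H v) s))).
    now apply HGc.
- intros r; rewrite (RInt_ext _ (fun _ => 0)).
  + rewrite RInt_const; apply Rmult_0_r.
  + intros s _; unfold H, radial_mean.
    rewrite (RInt_ext _ (fun _ => 0)).
    * rewrite RInt_const; change (g ((s - 0) * 0 / s ^ (n - 1)) = 0).
      rewrite Rmult_0_r; unfold Rdiv; rewrite Rmult_0_l; exact Hg0.
    * intros t _; rewrite Hf0, 2!Rmult_0_r; reflexivity.
- intros v v' delta Hv Hv' Hvv r.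
  assert (Hdelta : 0 <= delta).
  { assert (H1 := Hvv 0); assert (H2 := Rabs_pos (v 0 - v' 0)); specialize (HE 0).
    apply Rnot_lt_le; intros Hneg; nra. }
  set (k := Lg * (Kmax * Lf * delta / L)).
  assert (Hk : 0 <= k).
  { unfold k; apply Rmult_le_pos; [lra|]; apply Rdiv_le_0_compat; [|lra].
    repeat apply Rmult_le_pos; lra. }
  assert (Hdiff : RInt (fun s => g (radial_mean n (H v) s)) 0 (clamp 0 Tm r)
     - RInt (fun s => g (radial_mean n (H v') s)) 0 (clamp 0 Tm r) =
     RInt (fun s => g (radial_mean n (H v) s) - g (radial_mean n (H v') s)) 0 (clamp 0 Tm r)).
  { symmetry; apply (RInt_minus (fun s => g (radial_mean n (H v) s))
      (fun s => g (radial_mean n (H v') s))).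
    - apply (ex_RInt_continuous (fun s => g (radial_mean n (H v) s))); intros; now apply HGc.
    - apply (ex_RInt_continuous (fun s => g (radial_mean n (H v') s))); intros; now apply HGc. }
  rewrite Hdiff.
  apply Rle_trans with (k / L * exp (L * clamp 0 Tm r)).
  + apply RInt_exp_bound; [lra | exact Hk | apply Hcl | |].
    * intros t; apply (continuous_minus (V := R_NormedModule)); now apply HGc.
    * intros s Hs; specialize (Hcl r).
      apply Rle_trans with (1 := Hg _ _); unfold k; rewrite Rmult_assoc.
      apply Rmult_le_compat_l; [lra|].
      rewrite radial_mean_minus by auto.
      apply (radial_mean_exp_bound n (fun t => H v t - H v' t) (Kmax * Lf * delta) L s);
        [lra | repeat apply Rmult_le_pos; lra | lra | |].
      -- intros t; apply (continuous_minus (V := R_NormedModule)); now apply HHc.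
      -- intros t Ht; unfold H.
         replace (K t * f (v t) - K t * f (v' t)) with (K t * (f (v t) - f (v' t))) by ring.
         rewrite Rabs_mult, 2!Rmult_assoc.
         apply Rmult_le_compat; auto using Rabs_pos.
         apply Rle_trans with (1 := Hf _ _); apply Rmult_le_compat_l; [lra|].
         specialize (Hvv t); unfold E in Hvv; rewrite clamp_id in Hvv by lra; exact Hvv.
  + apply Rmult_le_compat_r; [left; apply exp_pos|].
    unfold k; apply Rmult_le_reg_r with (L * L); [nra|].
    replace (Lg * (Kmax * Lf * delta / L) / L * (L * L)) with (Lg * (Kmax * Lf) * delta)
      by (field; lra).
    assert (H1 : Lg * (Kmax * Lf) <= L / 2) by (unfold L; lra).
    assert (H2 : L <= L * L) by nra.
    apply Rle_trans with (L * L / 2 * delta); [apply Rmult_le_compat_r; lra | lra].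
- exists U, (2 * exp (L * Tm)); split; [assert (H1 := exp_pos (L * Tm)); lra|].
  split; [exact HU1|]; split; [exact HU2|]; split.
  + intros d r; apply Rle_trans with (1 := HU3 d r).
    replace (2 * exp (L * Tm) * Rabs d) with (2 * Rabs d * exp (L * Tm)) by ring.
    apply Rmult_le_compat_l; [assert (H1 := Rabs_pos d); lra | apply HE].
  + intros d d' r; apply Rle_trans with (1 := HU4 d d' r).
    replace (2 * exp (L * Tm) * Rabs (d - d')) with (2 * Rabs (d - d') * exp (L * Tm)) by ring.
    apply Rmult_le_compat_l; [assert (H1 := Rabs_pos (d - d')); lra | apply HE].
Qed.

Lemma signed_pow_clamp_lipschitz (a M : R) : 2 <= a -> 0 < M -> exists L, 0 < L /\
  (forall x y, Rabs (signed_pow a (clamp (- M) M x) - signed_pow a (clamp (- M) M y))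
     <= L * Rabs (x - y)) /\
  (forall x, Rabs (signed_pow a (clamp (- M) M x)) <= L * M).
Proof.
intros Ha HM.
destruct (signed_pow_lipschitz a M Ha) as [L [HL Hlip]].
assert (Hcl : forall x, Rabs (clamp (- M) M x) <= M).
{ intros x; apply Rabs_le_between, clamp_bounds; lra. }
exists L; split; [exact HL|]; split.
- intros x y; apply Rle_trans with (1 := Hlip _ _ (Hcl x) (Hcl y)).
  apply Rmult_le_compat_l; [lra | apply clamp_lipschitz].
- intros x; assert (H := Hlip (clamp (- M) M x) 0 (Hcl x) ltac:(rewrite Rabs_R0; lra)).
  rewrite signed_pow_0, 2!Rminus_0_r in H.
  apply Rle_trans with (1 := H), Rmult_le_compat_l; [lra | apply Hcl].
Qed.

(** Truncation does not increase [|y|], so the bound is free of [M]; it measures the nonlinearity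
    for small initial values. *)
Lemma signed_pow_clamp_le (a M Y y : R) : 1 < a -> 0 < M -> 0 < Y -> Rabs y <= Y ->
  Rabs (signed_pow a (clamp (- M) M y)) <= Rpower Y (a - 1).
Proof.
intros Ha HM HY Hy.
set (z := clamp (- M) M y).
assert (Hz : Rabs z <= Y).
{ assert (H := clamp_lipschitz (- M) M y 0).
  rewrite (clamp_id (- M) M 0), 2!Rminus_0_r in H by lra; unfold z; lra. }
unfold signed_pow; rewrite Rabs_mult, (Rabs_pos_eq (Rpower _ _)) by (left; apply Rpower_gt_0).
destruct (Req_dec z 0) as [-> | Hne].
- rewrite Rabs_R0, Rmult_0_l; left; apply Rpower_gt_0.
- assert (Hzp : 0 < Rabs z) by now apply Rabs_pos_lt.
  rewrite <- (Rpower_split (Rabs z) (a - 1) (a - 2)) by lra.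
  apply Rle_Rpower_l; lra.
Qed.

(* The nonlinearity truncated at level [M]; [W d] is the flux
   [- r^(n-1) u' |u'|^(p-2)] of [U d]. *)
Lemma truncated_family (n : nat) (p M Tm : R) (K : R -> R) :
  1 < p < INR n -> 2 * INR n / (INR n + 2) <= p -> p <= 2 ->
  C1_halfline K -> 0 < M -> 0 < Tm ->
  exists (U W : R -> R -> R) (C d0 : R), 0 < C /\ 0 < d0 /\
    (forall d r, continuous (U d) r) /\
    (forall d r, continuous (W d) r) /\
    (forall d, U d 0 = d) /\ (forall d, W d 0 = 0) /\
    (forall d d' r, Rabs (U d r - U d' r) <= C * Rabs (d - d')) /\
    (forall d r, 0 < d <= d0 -> 0 < U d r) /\
    (forall d r, 0 < r < Tm ->
       is_derive (U d) r (- signed_pow (p / (p - 1)) (W d r / r ^ (n - 1)))) /\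
    (forall d r, 0 < r < Tm ->
       is_derive (W d) r
         (r ^ (n - 1) * (K r * signed_pow (crit (INR n) p) (clamp (- M) M (U d r))))).
Proof.
intros Hp Hlow Hup HC1 HM HTm.
assert (Hn : (2 <= n)%nat).
{ 
  assert (H : 1 < INR n) by lra; change 1 with (INR 1) in H; apply INR_lt in H; lia. }
assert (Hq := crit_gt _ _ Hp).
(* The lower bound on [p] amounts to [q >= 2], and [p <= 2] to [p/(p-1) >= 2]: both powers in the
   system are then Lipschitz on bounded sets. *)
assert (Hq2 : 2 <= crit (INR n) p).
{ unfold crit; apply Rmult_le_reg_r with (INR n - p); [lra|].
  unfold Rdiv; rewrite Rmult_assoc, Rinv_l, Rmult_1_r by lra.
  apply (Rmult_le_compat_r (INR n + 2)) in Hlow; [|lra].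
  unfold Rdiv in Hlow; rewrite Rmult_assoc, Rinv_l in Hlow by lra; lra. }
assert (Hp2 : 2 <= p / (p - 1)).
{ apply Rmult_le_reg_r with (p - 1); [lra|].
  unfold Rdiv; rewrite Rmult_assoc, Rinv_l by lra; lra. }
(* A bounded continuous extension of [K] from [[0, Tm]] to the line. *)
set (K1 := fun r => K (clamp 0 Tm r)).
assert (HK1c : forall r, continuous K1 r).
{ intros r; apply continuous_R_intro; intros eps He.
  assert (Hcl := clamp_bounds 0 Tm).
  destruct (C1_halfline_continuous K (clamp 0 Tm r) HC1 (proj1 (Hcl r ltac:(lra))) eps He)
    as [delta [Hd Hs]].
  exists delta; split; [exact Hd|]; intros s Hsr; apply Hs; [apply Hcl; lra|].
  eapply Rle_lt_trans; [apply clamp_lipschitz | exact Hsr]. }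
destruct (continuity_ab_maj (fun r => Rabs (K1 r)) 0 Tm ltac:(lra)) as [rm [Hrm _]].
{ intros c _; apply continuity_pt_filterlim.
  apply (continuous_comp K1 Rabs); [apply HK1c | apply continuous_Rabs]. }
set (Kmax := Rabs (K1 rm) + 1).
assert (HKmax : 0 < Kmax) by (assert (H := Rabs_pos (K1 rm)); unfold Kmax; lra).
assert (HKb : forall r, Rabs (K1 r) <= Kmax).
{ intros r; assert (H := Hrm (clamp 0 Tm r) (clamp_bounds 0 Tm r ltac:(lra))).
  unfold K1 at 1 in H; rewrite (clamp_id 0 Tm (clamp 0 Tm r)) in H
    by (apply clamp_bounds; lra).
  fold (K1 r) in H; unfold Kmax; lra. }
set (f := fun y => signed_pow (crit (INR n) p) (clamp (- M) M y)).
destruct (signed_pow_clamp_lipschitz (crit (INR n) p) M Hq2 HM) as [Lf [HLf [Hflip Hfb]]].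
fold f in Hflip, Hfb.
(* Bounds the radial mean on [[0, Tm]], so truncating [g] at [Z] changes nothing there. *)
set (Z := Kmax * (Lf * M) * Tm).
assert (HZ : 0 < Z) by (unfold Z; pos).
set (g := fun y => signed_pow (p / (p - 1)) (clamp (- Z) Z y)).
destruct (signed_pow_clamp_lipschitz (p / (p - 1)) Z Hp2 HZ) as [Lg [HLg [Hglip _]]].
assert (Hf0 : f 0 = 0) by (unfold f; rewrite clamp_id, signed_pow_0; lra).
assert (Hg0 : g 0 = 0) by (unfold g; rewrite clamp_id, signed_pow_0; lra).
destruct (radial_ivp n Tm Kmax Lf (Lf * M) Lg K1 f g Hn HTm HLf HLg HK1c HKb Hflip Hf0
  Hfb Hglip Hg0) as [U [C [HC [HUc [HU [HUb HUd]]]]]].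
set (H := fun d t => K1 t * f (U d t)).
assert (HHc : forall d t, continuous (H d) t).
{ intros d t; apply (continuous_mult (K := R_AbsRing)); [apply HK1c|].
  apply (continuous_comp (U d) f); [apply HUc|].
  apply (lipschitz_continuous f Lf Hflip). }
assert (HHb : forall d t, Rabs (H d t) <= Kmax * (Lf * M)).
{ intros d t; unfold H; rewrite Rabs_mult.
  apply Rmult_le_compat; auto using Rabs_pos; apply Hfb. }
assert (HGc : forall d s, continuous (fun s => g (radial_mean n (H d) s)) s).
{ intros d s; apply (continuous_comp (radial_mean n (H d)) g).
  - apply (continuous_radial_mean n (H d) (Kmax * (Lf * M))); auto.
  - apply (lipschitz_continuous g Lg Hglip). }
set (W := fun d r => RInt (fun t => t ^ (n - 1) * H d t) 0 r).
assert (HW : forall d r, is_derive (W d) r (r ^ (n - 1) * H d r)).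
{ intros d r; apply (is_derive_RInt_continuous (fun t => t ^ (n - 1) * H d t)).
  apply continuous_pow_mult, HHc. }
(* [e = (q-1)/(p-1) > 1] because [q > p]: the integral subtracted from [d] is [O(d^e)], hence at
   most [d/2] for small [d]. *)
set (e := (crit (INR n) p - 1) * (p / (p - 1) - 1)).
assert (He : 1 < e).
{ unfold e; replace (p / (p - 1) - 1) with (/ (p - 1)) by (field; lra).
  apply Rmult_lt_reg_r with (p - 1); [lra|].
  rewrite Rmult_assoc, Rinv_l by lra; lra. }
set (c := Rpower (Kmax * Rpower C (crit (INR n) p - 1) * Tm) (p / (p - 1) - 1)).
assert (Hc : 0 < c) by apply Rpower_gt_0.
destruct (Rpower_small (e - 1) (Tm * c) (1 / 2)) as [d0 [Hd0 Hsmall]]; [lra | lra |].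
exists U, W, C, d0; do 2 (split; [assumption|]).
split; [exact HUc|].
split; [intros d r; eapply is_derive_continuous, HW|].
split; [|split; [|split; [exact HUd|split; [|split]]]].
- intros d; rewrite HU, clamp_id, RInt_point by lra; unfold zero; simpl; lra.
- intros d; unfold W; rewrite RInt_point; reflexivity.
- intros d r Hd.
  assert (Hcl := clamp_bounds 0 Tm r ltac:(lra)).
  assert (Hmean : forall s, 0 <= s <= Tm ->
     Rabs (radial_mean n (H d) s) <= Kmax * Rpower (C * d) (crit (INR n) p - 1) * Tm).
  { intros s Hs; eapply Rle_trans;
      [apply (radial_mean_bound n (H d) (Kmax * Rpower (C * d) (crit (INR n) p - 1)) s Hn (HHc d))|].
    - intros t; unfold H; rewrite Rabs_mult.
      apply Rmult_le_compat; auto using Rabs_pos.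
      apply signed_pow_clamp_le; try lra; [pos|].
      specialize (HUb d t); rewrite (Rabs_pos_eq d) in HUb; lra.
    - apply Rmult_le_compat_l; [left; pos | rewrite Rabs_pos_eq; lra]. }
  assert (HI : Rabs (RInt (fun s => g (radial_mean n (H d) s)) 0 (clamp 0 Tm r)) <=
     Rabs (clamp 0 Tm r - 0) * (c * Rpower d e)).
  { apply (norm_RInt_le_const_abs (V := R_NormedModule)
      (fun s => g (radial_mean n (H d) s)) 0 (clamp 0 Tm r)).
    - intros s; rewrite Rmin_left, Rmax_right by lra; intros Hs.
      change (Rabs (g (radial_mean n (H d) s)) <= c * Rpower d e).
      replace (c * Rpower d e) with
        (Rpower (Kmax * Rpower (C * d) (crit (INR n) p - 1) * Tm) (p / (p - 1) - 1)).
      + apply signed_pow_clamp_le; [lra | exact HZ | pos | apply Hmean; lra].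
      + unfold c, e; rpower_eq.
    - apply (RInt_correct (fun s => g (radial_mean n (H d) s))).
      apply (ex_RInt_continuous (fun s => g (radial_mean n (H d) s))); intros; apply HGc. }
  rewrite Rminus_0_r, (Rabs_pos_eq (clamp 0 Tm r)) in HI by lra.
  specialize (Hsmall d Hd).
  rewrite (Rpower_split d e (e - 1)) in HI by lra.
  assert (Hpe := Rpower_gt_0 d (e - 1)).
  assert (H1 : clamp 0 Tm r * (c * (d * Rpower d (e - 1))) <= Tm * (c * (d * Rpower d (e - 1))))
    by (apply Rmult_le_compat_r; [left; pos | lra]).
  assert (H2 : Tm * c * Rpower d (e - 1) * d <= 1 / 2 * d)
    by (apply Rmult_le_compat_r; lra).
  apply Rabs_le_between in HI; rewrite HU; fold (H d); lra.
- intros d r Hr.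
  apply (is_derive_ext_loc (fun r => d - RInt (fun s => g (radial_mean n (H d) s)) 0 r)).
  + assert (Hm : 0 < Rmin r (Tm - r)) by (apply Rmin_glb_lt; lra).
    exists (mkposreal _ Hm); intros s Hs.
    unfold ball in Hs; simpl in Hs;
      unfold AbsRing_ball, abs, minus, plus, opp in Hs; simpl in Hs.
    assert (H1 := Rmin_l r (Tm - r)); assert (H2 := Rmin_r r (Tm - r)).
    apply Rabs_lt_between in Hs.
    rewrite (HU d s), clamp_id by lra; reflexivity.
  + rewrite <- (Rminus_0_l (signed_pow _ _)).
    apply is_derive_Rminus; [exact (is_derive_const d r)|].
    replace (signed_pow (p / (p - 1)) (W d r / r ^ (n - 1))) with (g (radial_mean n (H d) r)).
    * apply (is_derive_RInt_continuous (fun s => g (radial_mean n (H d) s))), HGc.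
    * change (W d r / r ^ (n - 1)) with (radial_mean n (H d) r).
      unfold g; f_equal; apply clamp_id.
      assert (H1 := radial_mean_bound n (H d) (Kmax * (Lf * M)) r Hn (HHc d) (HHb d)).
      rewrite (Rabs_pos_eq r) in H1 by lra.
      assert (H2 : Kmax * (Lf * M) * r <= Z)
        by (unfold Z; apply Rmult_le_compat_l; [left; pos | lra]).
      apply Rabs_le_between in H1; lra.
- intros d r Hr.
  evar_last; [apply HW|].
  unfold H, K1, f; rewrite (clamp_id 0 Tm r) by lra; reflexivity.
Qed.

(** * Shooting *)

(** The truncation enters only the equation for [w], so [|u| <= M] is asked at the single point
    [r]. *)
Lemma radial_ode_of_system (n : nat) (p M Tm r : R) (K u w : R -> R) :
  1 < p < INR n -> 0 < r < Tm -> Rabs (u r) <= M ->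
  (forall r, 0 < r < Tm ->
     is_derive u r (- signed_pow (p / (p - 1)) (w r / r ^ (n - 1)))) ->
  (forall r, 0 < r < Tm ->
     is_derive w r
       (r ^ (n - 1) * (K r * signed_pow (crit (INR n) p) (clamp (- M) M (u r))))) ->
  radial_ode n p K u r.
Proof.
intros Hp Hr HM Hu Hw.
assert (Hfl : is_derive (fun s => s ^ (n - 1) * signed_pow p (Derive u s)) r
   (- (r ^ (n - 1) * (K r * signed_pow (crit (INR n) p) (u r))))).
{ apply (is_derive_ext_loc (fun s => - w s)).
  - assert (Hm : 0 < Rmin r (Tm - r)) by (apply Rmin_glb_lt; lra).
    exists (mkposreal _ Hm); intros s Hs.
    unfold ball in Hs; simpl in Hs;
      unfold AbsRing_ball, abs, minus, plus, opp in Hs; simpl in Hs.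
    assert (H1 := Rmin_l r (Tm - r)); assert (H2 := Rmin_r r (Tm - r)).
    apply Rabs_lt_between in Hs.
    rewrite (is_derive_unique _ _ _ (Hu s ltac:(lra))).
    rewrite signed_pow_opp, signed_pow_conj' by lra.
    change (- w s = s ^ (n - 1) * - (w s / s ^ (n - 1))).
    field; apply pow_nonzero; lra.
  - apply is_derive_Ropp; evar_last; [apply Hw, Hr|].
    rewrite clamp_id; [reflexivity | apply Rabs_le_between, HM]. }
unfold radial_ode; split; [eexists; apply Hu, Hr|]; split; [eexists; exact Hfl|].
replace (Derive (fun s : R => s ^ (n - 1) * signed_pow p (Derive u s)) r)
  with (- (r ^ (n - 1) * (K r * signed_pow (crit (INR n) p) (u r))))
  by (symmetry; exact (is_derive_unique _ _ _ Hfl)).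
change (critical_exponent n p) with (crit (INR n) p); ring.
Qed.

(** The flux becomes positive near [0], where [u > 0], and cannot decrease while [u >= 0]. The
    decrease is thus strict even at a zero of [u], which rules out an interior contact with [0]. *)
Lemma decreasing_of_system (n : nat) (p M Tm R0 : R) (K u w : R -> R) :
  1 < p < INR n -> 0 < M -> R0 < Tm -> 0 < u 0 -> w 0 = 0 ->
  (forall r, 0 <= r -> 0 < K r) ->
  (forall r, continuous u r) -> (forall r, continuous w r) ->
  (forall r, 0 < r < Tm ->
     is_derive u r (- signed_pow (p / (p - 1)) (w r / r ^ (n - 1)))) ->
  (forall r, 0 < r < Tm ->
     is_derive w r
       (r ^ (n - 1) * (K r * signed_pow (crit (INR n) p) (clamp (- M) M (u r))))) ->
  (forall r, 0 <= r <= R0 -> 0 <= u r) ->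
  forall r s, 0 <= r -> r < s -> s <= R0 -> u s < u r.
Proof.
intros Hp HM HR0 Hu0 Hw0 HK Huc Hwc Hdu Hdw Hpos.
assert (Hf : forall y, 0 < y -> 0 < signed_pow (crit (INR n) p) (clamp (- M) M y)).
{ intros y Hy; rewrite signed_pow_pos; [apply Rpower_gt_0|].
  unfold clamp; apply Rlt_le_trans with (Rmin y M); [now apply Rmin_glb_lt | apply Rmax_r]. }
assert (Hf' : forall y, 0 <= y -> 0 <= signed_pow (crit (INR n) p) (clamp (- M) M y)).
{ intros y [Hy | <-]; [left; auto|]; rewrite clamp_id, signed_pow_0; lra. }
assert (Hw : forall r, 0 < r <= R0 -> 0 < w r).
{ intros r Hr.
  destruct (continuous_R_elim u 0 (Huc 0) (u 0) Hu0) as [delta [Hdelta Hs]].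
  set (r1 := Rmin (delta / 2) r).
  assert (H1 : r1 <= delta / 2) by apply Rmin_l.
  assert (H2 : r1 <= r) by apply Rmin_r.
  assert (H3 : 0 < r1) by (apply Rmin_glb_lt; lra).
  apply Rlt_le_trans with (w r1).
  - rewrite <- Hw0.
    apply (lt_of_derive_gt_0 w (fun r =>
      r ^ (n - 1) * (K r * signed_pow (crit (INR n) p) (clamp (- M) M (u r))))); auto.
    + intros x Hx; apply Hdw; lra.
    + intros x Hx; specialize (Hs x).
      rewrite Rminus_0_r, Rabs_pos_eq in Hs by lra; specialize (Hs ltac:(lra)).
      apply Rabs_lt_between in Hs.
      apply Rmult_lt_0_compat; [apply pow_lt; lra|].
      apply Rmult_lt_0_compat; [apply HK; lra | apply Hf; lra].
  - apply (le_of_derive_ge_0 w (fun r =>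
      r ^ (n - 1) * (K r * signed_pow (crit (INR n) p) (clamp (- M) M (u r))))); auto.
    + intros x Hx; apply Hdw; lra.
    + intros x Hx; apply Rmult_le_pos; [apply pow_le; lra|].
      apply Rmult_le_pos; [left; apply HK; lra | apply Hf', Hpos; lra]. }
intros r s Hr Hrs Hs; apply Ropp_lt_cancel.
apply (lt_of_derive_gt_0 (fun t => - u t)
  (fun t => - - signed_pow (p / (p - 1)) (w t / t ^ (n - 1)))); [exact Hrs | | |].
- intros t Ht; apply is_derive_Ropp, Hdu; lra.
- intros t _; apply (continuous_opp (V := R_NormedModule)), Huc.
- intros t Ht; rewrite Ropp_involutive, signed_pow_pos; [apply Rpower_gt_0|].
  apply Rdiv_lt_0_compat; [apply Hw | apply pow_lt]; lra.
Qed.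

(** [d] is the supremum of the parameters up to which positivity persists. Lipschitz dependence
    gives [U d >= 0]; were [U d] positive, its minimum over the compact interval would be positive,
    and positivity would persist further or reach [M]. *)
Lemma first_vanishing_parameter (U : R -> R -> R) (C a M R0 : R) :
  0 < C -> 0 <= R0 -> a <= M ->
  (forall d r, continuous (U d) r) ->
  (forall d d' r, Rabs (U d r - U d' r) <= C * Rabs (d - d')) ->
  (forall r, 0 <= r <= R0 -> 0 < U a r) ->
  ~ (forall r, 0 <= r <= R0 -> 0 < U M r) ->
  exists d r, a <= d <= M /\ 0 <= r <= R0 /\ U d r <= 0 /\
    (forall s, 0 <= s <= R0 -> 0 <= U d s).
Proof.
intros HC HR0 HaM HUc HUd Ha HMn.
set (E := fun x => a <= x <= M /\
  forall d, a <= d <= x -> forall r, 0 <= r <= R0 -> 0 < U d r).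
assert (HEa : E a).
{ split; [lra|]; intros d Hd r Hr; replace d with a by lra; auto. }
destruct (completeness E) as [s [Hub Hlub]].
{ exists M; intros x [Hx _]; lra. }
{ exists a; exact HEa. }
assert (Has : a <= s) by (apply Hub, HEa).
assert (HsM : s <= M) by (apply Hlub; intros x [Hx _]; lra).
assert (Hbelow : forall d, a <= d < s -> forall r, 0 <= r <= R0 -> 0 < U d r).
{ intros d Hd.
  destruct (classic (exists x, E x /\ d < x)) as [[x [[_ HEx] Hdx]] | Hno].
  - apply HEx; lra.
  - exfalso; assert (s <= d); [|lra].
    apply Hlub; intros x HEx; apply Rnot_lt_le; intros Hlt; apply Hno; now exists x. }
assert (Hnonneg : forall r, 0 <= r <= R0 -> 0 <= U s r).
{ intros r Hr; destruct (Req_dec a s) as [<- | Hne]; [left; auto|].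
  apply le_epsilon; intros eps He.
  set (d := Rmax a (s - eps / C)).
  assert (Hec : 0 < eps / C) by pos.
  assert (H1 : a <= d) by apply Rmax_l.
  assert (H2 : s - eps / C <= d) by apply Rmax_r.
  assert (H3 : d < s) by (apply Rmax_lub_lt; lra).
  assert (H4 := Hbelow d (conj H1 H3) r Hr).
  assert (H5 := HUd d s r); rewrite (Rabs_minus_sym d s), (Rabs_pos_eq (s - d)) in H5 by lra.
  assert (H6 : C * (s - d) <= C * (eps / C)) by (apply Rmult_le_compat_l; lra).
  replace (C * (eps / C)) with eps in H6 by (field; lra).
  apply Rabs_le_between in H5; lra. }
destruct (classic (exists r, 0 <= r <= R0 /\ U s r <= 0)) as [[r [Hr Hle]] | Hno].
{ exists s, r; repeat split; try lra; apply Hnonneg; lra. }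
exfalso.
assert (Hpos : forall r, 0 <= r <= R0 -> 0 < U s r).
{ intros r Hr; apply Rnot_le_lt; intros Hle; apply Hno; now exists r. }
destruct (continuity_ab_min (U s) 0 R0 HR0) as [rm [Hmin Hrm]].
{ intros c _; apply continuity_pt_filterlim, HUc. }
assert (Hmu := Hpos rm Hrm).
(* A parameter change of at most [delta] moves [U] by at most half its minimum. *)
set (delta := U s rm / (2 * C)).
assert (Hdelta : 0 < delta) by (unfold delta; pos).
set (x := Rmin (s + delta) M).
assert (Hx1 : x <= s + delta) by apply Rmin_l.
assert (Hx2 : x <= M) by apply Rmin_r.
assert (HEx : E x).
{ split; [split; [apply Rmin_glb; lra | exact Hx2]|].
  intros d Hd r Hr.
  destruct (Rlt_dec d s) as [Hds | Hds]; [apply Hbelow; auto; lra|].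
  assert (H5 := HUd d s r); rewrite (Rabs_pos_eq (d - s)) in H5 by lra.
  assert (H6 : C * (d - s) <= C * delta) by (apply Rmult_le_compat_l; lra).
  replace (C * delta) with (U s rm / 2) in H6 by (unfold delta; field; lra).
  specialize (Hmin r Hr); apply Rabs_le_between in H5; lra. }
assert (Hxs := Hub x HEx).
assert (s = M).
{ unfold x, Rmin in Hxs; destruct (Rle_dec (s + delta) M) in Hxs; lra. }
subst s; contradiction.
Qed.

Lemma radial_solution_exists (n : nat) (p : R) (K h : R -> R) (A B l Rad : R) :
  1 < p < INR n -> 2 * INR n / (INR n + 2) <= p -> p <= 2 ->
  (forall r, 0 <= r -> 0 < K r) ->
  C1_halfline K -> 0 < A -> 0 < B -> 0 < l ->
  (forall r, 0 <= r -> K r = A + B * rpow r l + h r) ->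
  filterlim (fun r => (Rabs (h r) + r * Rabs (Derive h r)) / rpow r l)
    (at_right 0) (locally 0) ->
  l < ell_star n p -> 0 < Rad ->
  exists u, radial_solution n p K Rad u.
Proof.
intros Hp Hlow Hup HKpos HC1 HA HB Hl HK Hh Hlt HRad.
destruct (no_positive_regular_solution_large n p K h A B l Rad Hp HC1 HA HB Hl HK Hh Hlt HRad)
  as [M [HM Hlarge]].
(* The interval exceeds [Rad] so that the equation also holds at and slightly beyond [Rad]. *)
destruct (truncated_family n p M (Rad + 1) K Hp Hlow Hup HC1 HM ltac:(lra))
  as [U [W [C [d0 [HC [Hd0 [HUc [HWc [HU0 [HW0 [HUd [Hsmall [HdU HdW]]]]]]]]]]]]].
assert (Hdecr : forall d, 0 < d -> (forall r, 0 <= r <= Rad -> 0 <= U d r) ->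
  forall r s, 0 <= r -> r < s -> s <= Rad -> U d s < U d r).
{ intros d Hd Hpos.
  apply (decreasing_of_system n p M (Rad + 1) Rad K (U d) (W d)); auto; try lra.
  rewrite HU0; exact Hd. }
assert (Hode : forall d r, 0 < r < Rad + 1 -> Rabs (U d r) <= M -> radial_ode n p K (U d) r).
{ intros d r Hr Hle; apply (radial_ode_of_system n p M (Rad + 1) r K (U d) (W d)); auto. }
assert (Hlim : forall d, filterlim (U d) (at_right 0) (locally d)).
{ intros d; rewrite <- (HU0 d) at 2; intros P HP.
  destruct (HUc d 0 P HP) as [delta Hdelta].
  exists delta; intros y Hy _; now apply Hdelta. }
assert (Hle : forall d r, 0 < d -> (forall r, 0 <= r <= Rad -> 0 <= U d r) ->
   0 <= r <= Rad -> U d r <= d).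
{ intros d r Hd Hpos [[Hr | <-] Hr2]; [|rewrite HU0; lra].
  left; rewrite <- (HU0 d) at 2; apply Hdecr; auto; lra. }
set (a := Rmin d0 M).
assert (Ha1 : a <= d0) by apply Rmin_l.
assert (Ha2 : a <= M) by apply Rmin_r.
assert (Ha : 0 < a) by now apply Rmin_glb_lt.
destruct (first_vanishing_parameter U C a M Rad HC ltac:(lra) Ha2 HUc HUd)
  as [d [r0 [Hd [Hr0 [Hr0le Hnonneg]]]]].
{ intros r _; apply Hsmall; lra. }
(* If [U M] were positive it would stay below [M], hence solve the original equation, against
   [Hlarge]. *)
{ intros Hpos.
  assert (Hpos' : forall r, 0 <= r <= Rad -> 0 <= U M r) by (intros; left; auto).
  apply (Hlarge M (U M)); [lra | | intros r Hr; apply Hpos; lra].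
  split; [apply HU0|]; split; [apply Hlim|].
  intros r Hr; apply Hode; [lra|].
  assert (H1 := Hle M r HM Hpos' ltac:(lra)); assert (H2 := Hpos' r ltac:(lra)).
  rewrite Rabs_pos_eq; lra. }
assert (Hdpos : 0 < d) by lra.
specialize (Hdecr d Hdpos Hnonneg); specialize (fun r => Hle d r Hdpos Hnonneg).
(* After a zero inside the ball, strict decrease would make [U d] negative at [Rad]. *)
assert (Hr0Rad : r0 = Rad).
{ destruct (Req_dec r0 Rad) as [He | Hne]; [exact He | exfalso].
  assert (H1 := Hdecr r0 Rad ltac:(lra) ltac:(lra) ltac:(lra)).
  assert (H2 := Hnonneg Rad ltac:(lra)); lra. }
subst r0.
assert (Hzero : U d Rad = 0) by (apply Rle_antisym; [exact Hr0le | apply Hnonneg; lra]).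
(* Past [Rad] the sign is no longer controlled; continuity keeps [|U d| < M] there, so the equation
   still holds untruncated. *)
destruct (continuous_R_elim (U d) Rad (HUc d Rad) M HM) as [delta [Hdelta Hnear]].
assert (H1 := Rmin_l delta 1); assert (H2 := Rmin_r delta 1).
exists (U d), d, (Rad + Rmin delta 1).
split; [exact Hdpos|].
split; [assert (0 < Rmin delta 1) by (apply Rmin_glb_lt; lra); lra|].
split; [|split; [|exact Hzero]].
- split; [apply HU0|]; split; [apply Hlim|].
  intros r Hr; apply Hode; [lra|].
  destruct (Rle_dec r Rad) as [HrR | HrR].
  + assert (H3 := Hle r ltac:(lra)); assert (H4 := Hnonneg r ltac:(lra)).
    rewrite Rabs_pos_eq; lra.
  + specialize (Hnear r); rewrite (Rabs_pos_eq (r - Rad)) in Hnear by lra.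
    specialize (Hnear ltac:(lra)); rewrite Hzero, Rminus_0_r in Hnear; lra.
- intros r Hr; rewrite <- Hzero; apply Hdecr; lra.
Qed.

Theorem theorem1 (n : nat) (p : R) (K h : R -> R) (A B l : R)
  (hn : (0 < n)%nat)
  (hp1 : 1 < p) (hpn : p < INR n)
  (hp_low : 2 * INR n / (INR n + 2) <= p) (hp_up : p <= 2)
  (hKpos : forall r : R, 0 <= r -> 0 < K r)
  (hKC1 : C1_halfline K)
  (hA : 0 < A) (hB : 0 < B) (hl : 0 < l)
  (hK : forall r : R, 0 <= r -> K r = A + B * rpow r l + h r)
  (hh : filterlim (fun r => (Rabs (h r) + r * Rabs (Derive h r)) / rpow r l)
                  (at_right 0) (locally 0)) :
  (l < ell_star n p ->
     forall Rad : R, 0 < Rad -> exists u : R -> R, radial_solution n p K Rad u)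
  /\
  (ell_star n p <= l ->
     exists R0 : R, 0 < R0 /\
       forall Rad : R, 0 < Rad < R0 ->
         ~ (exists u : R -> R, radial_solution n p K Rad u)).
Proof.
assert (Hp : 1 < p < INR n) by lra.
split.
- intros Hlt Rad HRad.
  now apply (radial_solution_exists n p K h A B l Rad).
- intros Hle.
  now apply (no_radial_solution_small_ball n p K h A B l).
Qed.
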